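(* If $\eta=\mu$ and $\gamma\in(0,\bar\gamma_1)$, put $$b_2=\frac{c_{5,1}(\alpha_\gamma)g(1)}{1+\delta\bar\eta},\qquad x_{b_2}=c_{5,1}(\alpha_\gamma)[G(\alpha_\gamma)-G(1)]+b_2.$$ Then the function $v:[0,\infty)\to\mathbb{R}$, $v(0)=0$, given (and extended by continuity at $b_2$ and $x_{b_2}$) by $$v(x)=\begin{cases}\frac{[1+\delta\bar\eta]\,b_2^{1/[1+\delta\bar\eta]}}{\delta\bar\eta}x^{\delta\bar\eta/[1+\delta\bar\eta]}&x\in(0,b_2),\\[1mm] \frac{1}{\delta+\gamma}\Big\{\frac{c_{5,1}(\alpha_\gamma)}{\bar\eta}g\Big(G^{-1}\Big(\frac{x-b_2}{c_{5,1}(\alpha_\gamma)}+G(1)\Big)\Big)+\gamma[v(b_2)+x-b_2]\Big\}&x\in(b_2,x_{b_2}),\\[1mm] c_{3,2}(\alpha_\gamma)e^{\lambda_\gamma[x-x_{b_2}]}+\frac{\gamma}{\gamma+\delta}\big[x-b_2+v(b_2)+\frac{\mu}{\delta+\gamma}\big]&x\in(x_{b_2},\infty),\end{cases}$$ is a $C^2$, increasing and concave solution on $(0,\infty)$ of the HJB equation (see context), with $b_2=b_2^\gamma:=\inf\{x>0:v'(x)<1\}$. Furthermore, $v'/v''$ is decreasing on $(0,\infty)$ and satisfies $\lim_{x\downarrow0}\frac{\mu}{\sigma^2}\frac{v'(x)}{v''(x)}>-1$, and $$b_1^\gamma:=\inf\Big\{x>0:-\frac{\mu}{\sigma^2}\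frac{v'(x)}{v''(x)}\ge1\Big\}=c_{5,1}(\alpha_\gamma)[G(\alpha_\gamma)-G(1)]+b_2^\gamma.$$
   Context: Constants: $\mu=\eta>0$, $\sigma>0$, $\delta>0$, $\gamma>0$. HJB equation (with $\eta=\mu$): $$\max_{0\le u\le 1,\;0\le\xi\le x}\Big\{\tfrac12\sigma^2u^2v''(x)+u\mu v'(x)-\delta v(x)+\gamma[\xi+v(x-\xi)-v(x)]\Big\}=0\ \ (x>0),\qquad v(0)=0.$$ $\lambda_\gamma$ is the negative root of $\frac{\sigma^2}{2}r^2+\mu r-(\delta+\gamma)=0$. $f_1(\gamma)=\frac{1}{\lambda_\gamma\delta}\big[\delta+\frac{\lambda_\gamma\mu\gamma}{\delta+\gamma}\big]$ for $\gamma>0$ (strictly increasing), and $\bar\gamma_1=f_1^{-1}\big(\frac{\mu}{2\delta}\big)$. $\bar\eta=\frac{2\sigma^2}{\mu^2}$, $\alpha_\gamma=\frac{\gamma+\delta}{\gamma}\big[1+\frac{\mu}{\sigma^2\lambda_\gamma}\big]$ (one has $\alpha_\gamma>1$ for $\gamma\in(0,\bar\gamma_1)$), $c_{3,2}(\alpha_\gamma)=-\frac{\mu}{\sigma^2\alpha_\gamma\lambda_\gamma^2}$, $c_{5,1}(\alpha_\gamma)=\frac{\sigma^2}{\mu\alpha_\gamma g(\alpha_\gamma)}$. $g(x)=\frac{[\bar\eta\gamma]^{\bar\eta[\delta+\gamma]+1}}{\Gamma(\bar\eta[\delta+\gamma]+1)}x^{\bar\eta[\delta+\gamma]}e^{-\gamma\bar\eta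 x}$ ($x>0$) is the gamma density with shape $\bar\eta[\delta+\gamma]+1$ and rate $\gamma\bar\eta$; $G$ is its cumulative distribution function and $G^{-1}$ the inverse of $G$. *)

(* Defs.v *)
From Stdlib Require Import Reals.
From Coquelicot Require Import Coquelicot.
Open Scope R_scope.

(* The inverse of [f] on [D], by definite description: meaningful at every [y]
   attained exactly once on [D]. *)
Definition inverse_on (D : R -> Prop) (f : R -> R) (y : R) : R :=
  iota (fun x : R => D x /\ f x = y).

Definition half_line (x : R) : Prop := 0 < x.

Definition is_max (E : R -> Prop) (m : R) : Prop :=
  E m /\ is_upper_bound E m.

Definition strictly_increasing_on (D : R -> Prop) (f : R -> R) : Prop :=
  forall x y : R, D x -> D y -> x < y -> f x < f y.

Definition strictly_decreasing_on (D : R -> Prop) (f : R -> R) : Prop :=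
  forall x y : R, D x -> D y -> x < y -> f y < f x.

(* Used only for convex sets [D]. *)
Definition concave_on (D : R -> Prop) (f : R -> R) : Prop :=
  forall x y t : R, D x -> D y -> 0 <= t <= 1 ->
    t * f x + (1 - t) * f y <= f (t * x + (1 - t) * y).

(* Used only for open sets [D]; [ex_derive_n f 2] alone does not require [f]
   itself to be differentiable. *)
Definition C2_on (D : R -> Prop) (f : R -> R) : Prop :=
  forall x : R, D x ->
    ex_derive f x /\ ex_derive (Derive f) x /\ continuous (Derive_n f 2) x.

(* Euler's Gamma function, for [0 < s]. *)
Definition Gamma_fun (s : R) : R :=
  RInt_gen (fun t => Rpower t (s - 1) * exp (- t))
    (at_right 0) (Rbar_locally p_infty).

Definition gamma_density (shape rate x : R) : R :=
  Rpower rate shape / Gamma_fun shape * Rpower x (shape - 1) * exp (- rate * x).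

(* For [0 < x]. Starting at 0 is right because the density vanishes on the
   negative half-line; the conventional value of [Rpower 0 _] does not affect
   the integral. *)
Definition gamma_cdf (shape rate x : R) : R :=
  RInt (gamma_density shape rate) 0 x.

Definition lambda (mu sigma delta gamma : R) : R :=
  iota (fun r : R =>
    r < 0 /\ sigma ^ 2 / 2 * r ^ 2 + mu * r - (delta + gamma) = 0).

Definition f1 (mu sigma delta gamma : R) : R :=
  1 / (lambda mu sigma delta gamma * delta) *
  (delta + lambda mu sigma delta gamma * mu * gamma / (delta + gamma)).

Definition gamma_bar1 (mu sigma delta : R) : R :=
  inverse_on half_line (f1 mu sigma delta) (mu / (2 * delta)).

Definition eta_bar (mu sigma : R) : R := 2 * sigma ^ 2 / mu ^ 2.

Definition alpha (mu sigma delta gamma : R) : R :=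
  (gamma + delta) / gamma *
  (1 + mu / (sigma ^ 2 * lambda mu sigma delta gamma)).

Definition g (mu sigma delta gamma : R) : R -> R :=
  gamma_density (eta_bar mu sigma * (delta + gamma) + 1)
    (gamma * eta_bar mu sigma).

Definition G (mu sigma delta gamma : R) : R -> R :=
  gamma_cdf (eta_bar mu sigma * (delta + gamma) + 1)
    (gamma * eta_bar mu sigma).

Definition G_inv (mu sigma delta gamma : R) : R -> R :=
  inverse_on half_line (G mu sigma delta gamma).

Definition c32 (mu sigma delta gamma a : R) : R :=
  - (mu / (sigma ^ 2 * a * lambda mu sigma delta gamma ^ 2)).

Definition c51 (mu sigma delta gamma a : R) : R :=
  sigma ^ 2 / (mu * a * g mu sigma delta gamma a).

Definition b2 (mu sigma delta gamma : R) : R :=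
  c51 mu sigma delta gamma (alpha mu sigma delta gamma)
  * g mu sigma delta gamma 1
  / (1 + delta * eta_bar mu sigma).

Definition x_b2 (mu sigma delta gamma : R) : R :=
  let a := alpha mu sigma delta gamma in
  c51 mu sigma delta gamma a
  * (G mu sigma delta gamma a - G mu sigma delta gamma 1)
  + b2 mu sigma delta gamma.

Definition v_low (mu sigma delta gamma x : R) : R :=
  let k := delta * eta_bar mu sigma in
  (1 + k) * Rpower (b2 mu sigma delta gamma) (1 / (1 + k)) / k
  * Rpower x (k / (1 + k)).

(* The values at the two gluing points are the left limits, so that continuity
   there is part of what [C2_on] asserts; in particular [v(b2)] in the last two
   pieces is [v_low] at [b2]. The value on the negative half-line is
   irrelevant. *)
Definition v (mu sigma delta gamma x : R) : R :=
  let a := alpha mu sigma delta gamma in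
  let c := c51 mu sigma delta gamma a in
  let b := b2 mu sigma delta gamma in
  let xb := x_b2 mu sigma delta gamma in
  let vb := v_low mu sigma delta gamma b in
  if Rle_dec x 0 then 0
  else if Rle_dec x b then v_low mu sigma delta gamma x
  else if Rle_dec x xb then
    1 / (delta + gamma) *
    (c / eta_bar mu sigma
     * g mu sigma delta gamma
         (G_inv mu sigma delta gamma ((x - b) / c + G mu sigma delta gamma 1))
     + gamma * (vb + x - b))
  else
    c32 mu sigma delta gamma a
    * exp (lambda mu sigma delta gamma * (x - xb))
    + gamma / (gamma + delta) * (x - b + vb + mu / (delta + gamma)).

Definition HJB_expr (mu sigma delta gamma : R) (w : R -> R) (x u xi : R) : R :=
  1 / 2 * sigma ^ 2 * u ^ 2 * Derive_n w 2 x + u * mu * Derive w x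
  - delta * w x + gamma * (xi + w (x - xi) - w x).

Definition solves_HJB (mu sigma delta gamma : R) (w : R -> R) : Prop :=
  w 0 = 0 /\
  forall x : R, 0 < x ->
    is_max (fun y : R => exists u xi : R,
              0 <= u <= 1 /\ 0 <= xi <= x /\
              y = HJB_expr mu sigma delta gamma w x u xi) 0.

(* Main.v *)
Require Import Defs.
From Stdlib Require Import Reals Ranalysis5 Lra Psatz.
From Coquelicot Require Import Coquelicot.
Open Scope R_scope.

(* The middle piece is a curve parametrised by [y] in [[1, alpha]]: with
   [x = c (G y - G 1) + b2] one has [v'(x) = 1 / y] and
   [v''(x) = - 1 / (y^2 c g(y))], because [g' / g] is affine in [1 / y].  The
   constants make [v], [v'] and [v''] agree at [b2] and [x_b2], where [y] is 1
   and [alpha].  Since [v'' < 0] and [v'(b2) = 1], the best dividend pays out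
   down to [b2]; the unconstrained best control is
   [- mu / sigma^2 * v' / v''], which increases and reaches 1 at [x_b2].  On the
   middle piece it equals [y g(y) / (alpha g(alpha))], and it increases because
   [y g(y)] does so up to [(gamma + delta) / gamma > alpha].  The condition
   [gamma < gamma_bar1] amounts to [1 < alpha], as both reduce to
   [gamma < delta (1 + delta eta_bar)]. *)

(** * Gluing, monotonicity and inverse functions *)

(** The gamma density is forced by the middle piece. There the control is interior and the dividend
    pays down to [b2], so the equation reads [- v'^2 / (eta_bar * v'') = (delta + gamma) * v - gamma
    * (x - b2 + v b2)]. With [y = 1 / v'] as independent variable, [- v'^2 / v''] becomes [dx/dy],
    and differentiating in [y] leaves a linear equation: the logarithmic derivative of [dx/dy] is
    [eta_bar * ((delta + gamma) / y - gamma)], which is that of [g]. Hence [dx/dy = c * g y], and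
    [v] itself is read off the undifferentiated equation; this is the formula [mid]. Two obstacles
    shape the rest. The objects [lambda], [gamma_bar1], [G_inv] and [Gamma_fun] are definite
    descriptions, so each says nothing until existence and uniqueness, or convergence, is
    established. And a [C2] statement at the joints asks for two-sided derivatives, so every piece
    is treated as a function living on both sides of its end points. *)

Definition glue (a : R) (f1 f2 : R -> R) (x : R) : R :=
  if Rle_dec x a then f1 x else f2 x.

Lemma glue_left (a : R) (f1 f2 : R -> R) (x : R) :
  x <= a -> glue a f1 f2 x = f1 x.
Proof. intros H; unfold glue; destruct (Rle_dec x a); [reflexivity | lra]. Qed.

Lemma glue_right (a : R) (f1 f2 : R -> R) (x : R) :
  f1 a = f2 a -> a <= x -> glue a f1 f2 x = f2 x.
Proof.
  intros E H; unfold glue; destruct (Rle_dec x a); [| reflexivity].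
  replace x with a by lra; exact E.
Qed.

Lemma locally_lt (a x : R) : x < a -> locally x (fun y => y < a).
Proof. intros H; exact (open_lt a x H). Qed.

Lemma locally_gt (a x : R) : a < x -> locally x (fun y => a < y).
Proof. intros H; exact (open_gt a x H). Qed.

Lemma continuous_glue (l a : R) (f1 f2 : R -> R) :
  (forall x, l < x <= a -> continuous f1 x) ->
  (forall x, a <= x -> continuous f2 x) ->
  f1 a = f2 a ->
  forall x, l < x -> continuous (glue a f1 f2) x.
Proof.
  intros H1 H2 E x Hx.
  destruct (Rtotal_order x a) as [L | [-> | L]].
  - apply (continuous_ext_loc _ f1); [| apply H1; lra].
    apply (filter_imp (fun y => y < a)); [| exact (locally_lt a x L)].
    intros y Hy; symmetry; apply glue_left; lra.
  - apply filterlim_locally; intros eps.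
    assert (C1 := proj1 (filterlim_locally f1 (f1 a)) (H1 a (conj Hx (Rle_refl a))) eps).
    assert (C2 := proj1 (filterlim_locally f2 (f2 a)) (H2 a (Rle_refl a)) eps).
    generalize (filter_and _ _ C1 C2); apply filter_imp; intros y [B1 B2].
    rewrite (glue_left a f1 f2 a) by lra.
    destruct (Rle_dec y a).
    + rewrite glue_left by assumption; exact B1.
    + rewrite glue_right, E by (try assumption; lra); exact B2.
  - apply (continuous_ext_loc _ f2); [| apply H2; lra].
    apply (filter_imp (fun y => a < y)); [| exact (locally_gt a x L)].
    intros y Hy; symmetry; apply glue_right; [exact E | lra].
Qed.

(** Both pieces are differentiable on both sides of [a], with equal values and slopes there, so each
    difference quotient of the glued function at [a] is a quotient of one of them, and the smaller
    radius serves. *)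
Lemma is_derive_glue (l a : R) (f1 f2 d1 d2 : R -> R) :
  (forall x, l < x <= a -> is_derive f1 x (d1 x)) ->
  (forall x, a <= x -> is_derive f2 x (d2 x)) ->
  f1 a = f2 a -> d1 a = d2 a ->
  forall x, l < x -> is_derive (glue a f1 f2) x (glue a d1 d2 x).
Proof.
  intros H1 H2 E Ed x Hx.
  destruct (Rtotal_order x a) as [L | [-> | L]].
  - rewrite glue_left by lra.
    apply (is_derive_ext_loc f1); [| apply H1; lra].
    apply (filter_imp (fun y => y < a)); [| exact (locally_lt a x L)].
    intros y Hy; symmetry; apply glue_left; lra.
  - rewrite glue_left by lra.
    apply is_derive_Reals; intros eps Heps.
    assert (D1 := proj1 (is_derive_Reals f1 a (d1 a)) (H1 a (conj Hx (Rle_refl a))) eps Heps).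
    assert (D2 := proj1 (is_derive_Reals f2 a (d2 a)) (H2 a (Rle_refl a)) eps Heps).
    destruct D1 as [e1 D1], D2 as [e2 D2].
    assert (He : 0 < Rmin e1 e2) by (apply Rmin_pos; apply cond_pos).
    exists (mkposreal _ He); intros h Hh0 Hh; simpl in Hh.
    assert (B1 := Rmin_l e1 e2); assert (B2 := Rmin_r e1 e2).
    rewrite (glue_left a f1 f2 a) by lra.
    destruct (Rle_dec (a + h) a).
    + rewrite glue_left by assumption; apply D1; [assumption | lra].
    + rewrite glue_right, E, Ed by (try assumption; lra).
      apply D2; [assumption | lra].
  - rewrite glue_right by (try assumption; lra).
    apply (is_derive_ext_loc f2); [| apply H2; lra].
    apply (filter_imp (fun y => a < y)); [| exact (locally_gt a x L)].
    intros y Hy; symmetry; apply glue_right; [exact E | lra].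
Qed.

Lemma glue_strictly_decreasing (l a : R) (f1 f2 : R -> R) :
  strictly_decreasing_on (fun x => l < x <= a) f1 ->
  strictly_decreasing_on (fun x => a <= x) f2 ->
  f1 a = f2 a ->
  strictly_decreasing_on (fun x => l < x) (glue a f1 f2).
Proof.
  intros H1 H2 E x y Hx Hy Hxy.
  destruct (Rle_lt_dec y a).
  { rewrite !glue_left by lra; apply H1; lra. }
  rewrite (glue_right a f1 f2 y) by (try assumption; lra).
  destruct (Rle_lt_dec a x).
  { rewrite glue_right by assumption; apply H2; lra. }
  rewrite glue_left by lra.
  apply Rlt_trans with (f1 a); [rewrite E; apply H2; lra | apply H1; lra].
Qed.

Lemma mean_value (f df : R -> R) (x y : R) :
  x < y -> (forall t, x <= t <= y -> is_derive f t (df t)) ->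
  exists t, x <= t <= y /\ f y - f x = df t * (y - x).
Proof.
  intros Hxy H.
  destruct (MVT_gen f x y df) as [t Ht].
  - rewrite Rmin_left, Rmax_right by lra; intros t Ht; apply H; lra.
  - rewrite Rmin_left, Rmax_right by lra; intros t Ht.
    apply derivable_continuous_pt; exists (df t).
    apply is_derive_Reals, H; exact Ht.
  - rewrite Rmin_left, Rmax_right in Ht by lra; exists t; exact Ht.
Qed.

Lemma increasing_of_derive_pos (f df : R -> R) :
  (forall x, 0 < x -> is_derive f x (df x)) ->
  (forall x, 0 < x -> 0 < df x) ->
  strictly_increasing_on half_line f.
Proof.
  intros H P x y Hx Hy Hxy; unfold half_line in *.
  destruct (mean_value f df x y Hxy) as [t [Ht E]].
  - intros t Ht; apply H; lra.
  - assert (0 < df t * (y - x)) by (apply Rmult_lt_0_compat; [apply P |]; lra); lra.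
Qed.

Lemma decreasing_of_derive_neg (f df : R -> R) :
  (forall x, 0 < x -> is_derive f x (df x)) ->
  (forall x, 0 < x -> df x < 0) ->
  strictly_decreasing_on half_line f.
Proof.
  intros H P x y Hx Hy Hxy; unfold half_line in *.
  destruct (mean_value f df x y Hxy) as [t [Ht E]].
  - intros t Ht; apply H; lra.
  - assert (df t < 0) by (apply P; lra); nra.
Qed.

(** An intermediate point [z] cuts the chord in two; by the mean value theorem the slopes of the
    parts are values of [df] at points separated by [z], so the left part is at least as steep. *)
Lemma concave_of_derive_decreasing (f df : R -> R) :
  (forall x, 0 < x -> is_derive f x (df x)) ->
  strictly_decreasing_on half_line df ->
  concave_on half_line f.
Proof.
  intros H D.
  assert (W : forall x y t, 0 < x -> x < y -> 0 <= t <= 1 ->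
    t * f x + (1 - t) * f y <= f (t * x + (1 - t) * y)).
  { intros x y t Hx Hxy Ht.
    destruct (Req_dec t 0) as [-> | T0].
    { replace (0 * x + (1 - 0) * y) with y by ring; lra. }
    destruct (Req_dec t 1) as [-> | T1].
    { replace (1 * x + (1 - 1) * y) with x by ring; lra. }
    set (z := t * x + (1 - t) * y).
    assert (Z1 : z - x = (1 - t) * (y - x)) by (unfold z; ring).
    assert (Z2 : y - z = t * (y - x)) by (unfold z; ring).
    assert (x < z) by nra. assert (z < y) by nra.
    destruct (mean_value f df x z) as [u [Hu Eu]]; [lra | intros; apply H; lra |].
    destruct (mean_value f df z y) as [w [Hw Ew]]; [lra | intros; apply H; lra |].
    assert (Duw : df w <= df u).
    { destruct (Req_dec u w) as [-> | N]; [lra |].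
      left; apply D; unfold half_line; lra. }
    rewrite Z1 in Eu; rewrite Z2 in Ew.
    assert (0 <= t * (1 - t) * (y - x)) by (apply Rmult_le_pos; [apply Rmult_le_pos |]; lra).
    nra. }
  intros x y t Hx Hy Ht; unfold half_line in *.
  destruct (Rtotal_order x y) as [L | [-> | L]].
  - apply W; assumption.
  - replace (t * y + (1 - t) * y) with y by ring; lra.
  - replace (t * x + (1 - t) * y) with ((1 - t) * y + (1 - (1 - t)) * x) by ring.
    replace (t * f x + (1 - t) * f y) with ((1 - t) * f y + (1 - (1 - t)) * f x) by ring.
    apply W; lra.
Qed.

Lemma is_derive_continuity_pt (f : R -> R) (x l : R) :
  is_derive f x l -> continuity_pt f x.
Proof.
  intros H; apply derivable_continuous_pt; exists l; apply is_derive_Reals; exact H.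
Qed.

(** [Y] is only known to undo [F]. On the image of [[y / 2, 2 * y]] the intermediate value theorem
    makes it a right inverse too, and there the inverse function theorem for intervals applies. *)
Lemma is_derive_left_inverse (F dF Y : R -> R) :
  (forall y, 0 < y -> is_derive F y (dF y)) ->
  (forall y, 0 < y -> 0 < dF y) ->
  (forall y, 0 < y -> Y (F y) = y) ->
  forall y, 0 < y -> is_derive Y (F y) (/ dF y).
Proof.
  intros H P K y Hy.
  assert (I := increasing_of_derive_pos F dF H P); unfold strictly_increasing_on, half_line in I.
  assert (L1 : F (y / 2) < F y) by (apply I; lra).
  assert (L2 : F y < F (2 * y)) by (apply I; lra).
  assert (C : forall t, y / 2 <= t <= 2 * y -> continuity_pt F t).
  { intros t Ht; apply (is_derive_continuity_pt _ _ (dF t)), H; lra. }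
  assert (CY : continuity_pt Y (F y)).
  { apply (continuity_pt_recip_prelim F Y (y / 2) (2 * y)).
    - lra.
    - intros; apply I; lra.
    - intros t Ht; unfold comp, id; apply K; lra.
    - exact C.
    - lra. }
  assert (Prf : forall t, Y (F (y / 2)) <= t <= Y (F (2 * y)) -> derivable_pt F t).
  { intros t Ht; rewrite !K in Ht by lra.
    exists (dF t); apply is_derive_Reals, H; lra. }
  assert (Prg : Y (F (y / 2)) <= Y (F y) <= Y (F (2 * y))) by (rewrite !K; lra).
  assert (E : derive_pt F (Y (F y)) (Prf (Y (F y)) Prg) = dF y).
  { rewrite Derive_Reals, K by lra; apply is_derive_unique, H, Hy. }
  assert (D : derivable_pt_lim Y (F y) (1 / derive_pt F (Y (F y)) (Prf (Y (F y)) Prg))).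
  { apply (derivable_pt_lim_recip_interv F Y (F (y / 2)) (F (2 * y)) (F y)).
    - exact CY.
    - lra.
    - lra.
    - intros x Hx; unfold comp, id.
      destruct (f_interv_is_interv F (y / 2) (2 * y) x) as [t [Ht <-]]; [lra | exact Hx | exact C |].
      rewrite K by lra; reflexivity.
    - rewrite E; assert (Q := P y Hy); lra. }
  rewrite E in D; apply is_derive_Reals in D.
  replace (/ dF y) with (1 / dF y); [exact D | unfold Rdiv; ring].
Qed.

(** Membership of [a] is left open because both cases occur: the set defining [b2g] omits its
    infimum, the one defining [b1g] attains it. *)
Lemma Glb_Rbar_up_set (E : R -> Prop) (a : R) :
  (forall x, E x -> a <= x) -> (forall x, a < x -> E x) -> Glb_Rbar E = Finite a.
Proof.
  intros H1 H2; apply is_glb_Rbar_unique; split.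
  - intros x Hx; exact (H1 x Hx).
  - intros [m | |] Hm; simpl.
    + apply Rnot_lt_le; intros L.
      assert (Q := Hm ((a + m) / 2) (H2 ((a + m) / 2) ltac:(lra))); simpl in Q; lra.
    + exact (Hm (a + 1) (H2 (a + 1) ltac:(lra))).
    + exact I.
Qed.

(** * The gamma density *)

(* The extension by 0 of [t^s exp (- r t)]; [Rpower 0 s] is 1, not 0. *)
Definition power_exp (s r t : R) : R :=
  if Rle_dec t 0 then 0 else Rpower t s * exp (- r * t).

Lemma power_exp_of_pos (s r t : R) :
  0 < t -> power_exp s r t = Rpower t s * exp (- r * t).
Proof. intros H; unfold power_exp; destruct (Rle_dec t 0); [lra | reflexivity]. Qed.

Lemma power_exp_pos (s r t : R) : 0 < t -> 0 < power_exp s r t.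
Proof.
  intros H; rewrite power_exp_of_pos by assumption.
  apply Rmult_lt_0_compat; apply exp_pos.
Qed.

Lemma continuous_power_exp (s r t : R) : 0 < s -> 0 < r -> continuous (power_exp s r) t.
Proof.
  intros Hs Hr; destruct (Rtotal_order t 0) as [L | [-> | L]].
  - apply (continuous_ext_loc _ (fun _ => 0)); [| apply continuous_const].
    apply (filter_imp (fun y => y < 0)); [| exact (locally_lt 0 t L)].
    intros y Hy; unfold power_exp; destruct (Rle_dec y 0); [reflexivity | lra].
  - apply filterlim_locally; intros eps.
    (* The exponential is at most 1 for positive arguments, so [t ^ s < eps] is enough. *)
    exists (mkposreal (Rpower eps (/ s)) (exp_pos _)); intros y Hy.
    change (Rabs (y - 0) < Rpower eps (/ s)) in Hy; rewrite Rminus_0_r in Hy.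
    change (Rabs (power_exp s r y - power_exp s r 0) < eps).
    assert (He := cond_pos eps).
    unfold power_exp; destruct (Rle_dec 0 0); [| lra]; rewrite Rminus_0_r.
    destruct (Rle_dec y 0); [rewrite Rabs_R0; exact He |].
    rewrite Rabs_pos_eq in Hy by lra.
    assert (P : Rpower y s < eps).
    { replace (pos eps) with (Rpower (Rpower eps (/ s)) s).
      - apply Rlt_Rpower_l; lra.
      - rewrite Rpower_mult, Rinv_l, Rpower_1 by lra; reflexivity. }
    assert (Q : exp (- r * y) <= 1).
    { rewrite <- exp_0; left; apply exp_increasing; nra. }
    assert (0 < Rpower y s) by apply exp_pos.
    assert (0 < exp (- r * y)) by apply exp_pos.
    rewrite Rabs_pos_eq by nra; nra.
  - apply (continuous_ext_loc _ (fun t => Rpower t s * exp (- r * t))).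
    + apply (filter_imp (fun y => 0 < y)); [| exact (locally_gt 0 t L)].
      intros y Hy; symmetry; apply power_exp_of_pos, Hy.
    + apply (ex_derive_continuous (fun t => Rpower t s * exp (- r * t))).
      unfold Rpower; auto_derive; exact L.
Qed.

Lemma ex_RInt_power_exp (s r x y : R) : 0 < s -> 0 < r -> ex_RInt (power_exp s r) x y.
Proof.
  intros Hs Hr; apply (ex_RInt_continuous (V := R_CompleteNormedModule)); intros; apply continuous_power_exp; assumption.
Qed.

Lemma is_derive_RInt_power_exp (s r x : R) :
  0 < s -> 0 < r -> is_derive (RInt (power_exp s r) 0) x (power_exp s r x).
Proof.
  intros Hs Hr; apply (is_derive_RInt _ _ 0).
  - apply filter_forall; intros y; apply (RInt_correct (V := R_CompleteNormedModule)), ex_RInt_power_exp; assumption.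
  - apply continuous_power_exp; assumption.
Qed.

(* From [ln u <= u] with [u = t / (2 s)]. *)
Lemma power_exp_le (s t : R) :
  0 < s -> 0 < t -> power_exp s 1 t <= Rpower (2 * s) s * exp (- (t / 2)).
Proof.
  intros Hs Ht; rewrite power_exp_of_pos by assumption; unfold Rpower.
  rewrite <- !exp_plus.
  assert (E : ln t = ln (t / (2 * s)) + ln (2 * s)).
  { rewrite <- ln_mult.
    - f_equal; field; lra.
    - apply Rdiv_lt_0_compat; lra.
    - lra. }
  assert (L : ln (t / (2 * s)) <= t / (2 * s)).
  { assert (0 < t / (2 * s)) by (apply Rdiv_lt_0_compat; lra).
    assert (Q := exp_ineq1_le (ln (t / (2 * s)))); rewrite exp_ln in Q by assumption; lra. }
  assert (M : s * ln (t / (2 * s)) <= t / 2).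
  { replace (t / 2) with (s * (t / (2 * s))) by (field; lra).
    apply Rmult_le_compat_l; lra. }
  assert (N : s * ln t + - (1) * t <= s * ln (2 * s) + - (t / 2)).
  { rewrite E, Rmult_plus_distr_l; lra. }
  destruct N as [N | N]; [left; apply exp_increasing; exact N | right; rewrite N; reflexivity].
Qed.

Lemma RInt_power_exp_bounded (s x : R) :
  0 < s -> 0 < x -> RInt (power_exp s 1) 0 x <= 2 * Rpower (2 * s) s.
Proof.
  intros Hs Hx; set (C := Rpower (2 * s) s).
  assert (HC : 0 < C) by apply exp_pos.
  (* By [power_exp_le] the added exponential makes this function nonincreasing, so its value at [x]
     is at most its value [2 * C] at 0. *)
  destruct (mean_value (fun t => RInt (power_exp s 1) 0 t + 2 * C * exp (- (t / 2)))
    (fun t => power_exp s 1 t - C * exp (- (t / 2))) 0 x Hx) as [t [Ht E]].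
  - intros t Ht.
    apply (is_derive_plus (V := R_NormedModule) (RInt (power_exp s 1) 0)
      (fun t => 2 * C * exp (- (t / 2))) t (power_exp s 1 t) (- (C * exp (- (t / 2))))).
    + apply is_derive_RInt_power_exp; lra.
    + auto_derive; [exact I |]. unfold Rdiv; field.
  - rewrite RInt_point in E; change (@zero R_NormedModule) with 0 in E.
    replace (- (0 / 2)) with 0 in E by field; rewrite exp_0 in E.
    assert (D : power_exp s 1 t - C * exp (- (t / 2)) <= 0).
    { destruct (Req_dec t 0) as [-> | T].
      - unfold power_exp; destruct (Rle_dec 0 0); [| lra].
        assert (0 < exp (- (0 / 2))) by apply exp_pos; nra.
      - assert (Q := power_exp_le s t Hs ltac:(lra)); fold C in Q; lra. }
    assert (0 < exp (- (x / 2))) by apply exp_pos.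
    assert (0 < C * exp (- (x / 2))) by (apply Rmult_lt_0_compat; assumption).
    assert ((power_exp s 1 t - C * exp (- (t / 2))) * (x - 0) <= 0) by nra.
    unfold zero in E; simpl in E; lra.
Qed.

Lemma RInt_power_exp_increasing (s r : R) :
  0 < s -> 0 < r -> forall x y, 0 <= x -> x < y ->
  RInt (power_exp s r) 0 x < RInt (power_exp s r) 0 y.
Proof.
  intros Hs Hr x y Hx Hxy.
  rewrite <- (RInt_Chasles (power_exp s r) 0 x y) by (apply ex_RInt_power_exp; assumption).
  assert (0 < RInt (power_exp s r) x y).
  { apply RInt_gt_0; [exact Hxy | |].
    - intros t Ht; apply power_exp_pos; lra.
    - intros t _; apply continuous_power_exp; assumption. }
  unfold plus; simpl; lra.
Qed.

(** The strict bound [F 0 < l] is what later makes the Gamma function positive. *)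
Lemma bounded_increasing_limit (F : R -> R) (M : R) :
  (forall x y, 0 <= x -> x < y -> F x < F y) -> (forall x, 0 < x -> F x <= M) ->
  exists l, F 0 < l /\ filterlim F (Rbar_locally p_infty) (locally l).
Proof.
  intros Hi Hb.
  destruct (completeness (fun z => exists x, 0 < x /\ z = F x)) as [l [U L]].
  - exists M; intros z [x [Hx ->]]; apply Hb, Hx.
  - exists (F 1), 1; split; [lra | reflexivity].
  - exists l; split.
    + apply Rlt_le_trans with (F 1); [apply Hi; lra | apply U; exists 1; split; [lra | reflexivity]].
    + apply filterlim_locally; intros eps.
      assert (He := cond_pos eps).
      destruct (Classical_Prop.classic (exists x, 0 < x /\ l - eps < F x)) as [[x [Hx Lx]] | N].
      * exists x; intros y Hy; change (Rabs (F y - l) < eps).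
        assert (F x < F y) by (apply Hi; lra).
        assert (F y <= l) by (apply U; exists y; split; [lra | reflexivity]).
        rewrite Rabs_left1; lra.
      * assert (l <= l - eps); [| lra].
        apply L; intros z [x [Hx ->]]; apply Rnot_lt_le; intros Q; apply N; exists x; split; assumption.
Qed.

(** For [1 < shape] the integrand extends continuously by 0 at the origin, so it has a primitive [F]
    on the whole line; the improper integral then converges to the limit of [F] at infinity minus
    [F 0]. *)
Lemma Gamma_fun_pos (shape : R) : 1 < shape -> 0 < Gamma_fun shape.
Proof.
  intros Hs; set (s := shape - 1); assert (Hs' : 0 < s) by (unfold s; lra).
  set (F := RInt (power_exp s 1) 0).
  assert (DF : forall x, is_derive F x (power_exp s 1 x))
    by (intros x; apply is_derive_RInt_power_exp; lra).
  assert (F0 : F 0 = 0) by (unfold F; rewrite RInt_point; reflexivity).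
  destruct (bounded_increasing_limit F (2 * Rpower (2 * s) s)) as [l [Hl Lim]].
  - intros; apply RInt_power_exp_increasing; lra.
  - intros; apply RInt_power_exp_bounded; assumption.
  - assert (D : forall x, Derive F x = power_exp s 1 x) by (intros x; apply is_derive_unique, DF).
    assert (H : is_RInt_gen (Derive F) (at_right 0) (Rbar_locally p_infty) (l - F 0)).
    { apply is_RInt_gen_Derive.
      - apply filter_forall; intros ab x _; exists (power_exp s 1 x); apply DF.
      - apply filter_forall; intros ab x _.
        apply (continuous_ext (power_exp s 1)); [intros; symmetry; apply D |].
        apply continuous_power_exp; lra.
      - apply (filterlim_filter_le_1 (G := at_right 0) (F := locally 0)).
        + intros P HP; exact (filter_imp (F := locally 0) P _ (fun x Hx _ => Hx) HP).
        + apply (ex_derive_continuous F 0); exists (power_exp s 1 0); apply DF.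
      - exact Lim. }
    unfold Gamma_fun; rewrite (is_RInt_gen_unique (V := R_CompleteNormedModule) _ (l - F 0)); [lra |].
    apply (is_RInt_gen_ext (Derive F)); [| exact H].
    apply (Filter_prod _ _ _ (fun x => 0 < x) (fun x => 0 < x)).
    + exists (mkposreal 1 Rlt_0_1); intros y _ Hy; exact Hy.
    + exists 0; intros y Hy; exact Hy.
    + intros a b Ha Hb x Hx; simpl in Hx.
      assert (0 < Rmin a b) by (apply Rmin_pos; assumption).
      rewrite D, power_exp_of_pos by lra; fold s; do 2 f_equal; ring.
Qed.

Lemma gamma_density_pos (shape rate x : R) : 1 < shape -> 0 < gamma_density shape rate x.
Proof.
  intros Hs; unfold gamma_density.
  repeat apply Rmult_lt_0_compat; try apply exp_pos.
  apply Rinv_0_lt_compat, Gamma_fun_pos, Hs.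
Qed.

Lemma is_derive_gamma_density (shape rate x : R) :
  0 < x ->
  is_derive (gamma_density shape rate) x
    (gamma_density shape rate x * ((shape - 1) / x - rate)).
Proof.
  intros Hx; unfold gamma_density.
  generalize (Rpower rate shape / Gamma_fun shape); intros K.
  unfold Rpower; auto_derive; [exact Hx | field; lra].
Qed.

(** The density as written jumps at 0, where [Rpower] is 1. Under the integral it is replaced by a
    multiple of the continuous [power_exp], with which it agrees inside the interval. *)
Lemma is_derive_gamma_cdf (shape rate x : R) :
  1 < shape -> 0 < rate -> 0 < x ->
  is_derive (gamma_cdf shape rate) x (gamma_density shape rate x).
Proof.
  intros Hs Hr Hx; set (K := Rpower rate shape / Gamma_fun shape).
  apply (is_derive_ext_loc (fun y => K * RInt (power_exp (shape - 1) rate) 0 y)).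
  - apply (filter_imp (fun y => 0 < y)); [| exact (locally_gt 0 x Hx)].
    intros y Hy; unfold gamma_cdf.
    rewrite <- (RInt_scal (V := R_CompleteNormedModule)) by (apply ex_RInt_power_exp; lra).
    apply RInt_ext; intros t Ht; rewrite Rmin_left in Ht by lra.
    unfold scal; simpl; unfold mult; simpl.
    rewrite power_exp_of_pos by lra; unfold gamma_density; fold K; ring.
  - replace (gamma_density shape rate x) with (K * power_exp (shape - 1) rate x)
      by (rewrite power_exp_of_pos by assumption; unfold gamma_density; fold K; ring).
    apply (is_derive_scal (RInt (power_exp (shape - 1) rate) 0)).
    apply is_derive_RInt_power_exp; lra.
Qed.

Lemma gamma_cdf_increasing (shape rate : R) :
  1 < shape -> 0 < rate -> strictly_increasing_on half_line (gamma_cdf shape rate).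
Proof.
  intros Hs Hr; apply (increasing_of_derive_pos _ (gamma_density shape rate)).
  - intros; apply is_derive_gamma_cdf; assumption.
  - intros; apply gamma_density_pos; assumption.
Qed.

Lemma gamma_cdf_inverse (shape rate x : R) :
  1 < shape -> 0 < rate -> 0 < x ->
  inverse_on half_line (gamma_cdf shape rate) (gamma_cdf shape rate x) = x.
Proof.
  intros Hs Hr Hx; unfold inverse_on; apply (iota_unique (V := R_CompleteNormedModule)); [| split; [exact Hx | reflexivity]].
  intros y [Hy E]; assert (I := gamma_cdf_increasing shape rate Hs Hr).
  destruct (Rtotal_order y x) as [L | [-> | L]]; [| reflexivity |];
    apply I in L; try assumption; lra.
Qed.

(** * The root [lambda] and the threshold [gamma_bar1] *)

Lemma lambda_eq (mu sigma delta gamma r : R) :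
  0 < sigma -> 0 < delta + gamma -> r < 0 ->
  sigma ^ 2 / 2 * r ^ 2 + mu * r - (delta + gamma) = 0 ->
  lambda mu sigma delta gamma = r.
Proof.
  intros Hs Hd Hr E; unfold lambda; apply (iota_unique (V := R_CompleteNormedModule)); [| split; assumption].
  intros y [Hy Ey].
  assert (0 < sigma ^ 2 / 2) by nra.
  (* The product of the two roots is negative. *)
  assert (P : (y - r) * (sigma ^ 2 / 2 * y * r + (delta + gamma)) = 0).
  { replace ((y - r) * (sigma ^ 2 / 2 * y * r + (delta + gamma))) with
      (r * (sigma ^ 2 / 2 * y ^ 2 + mu * y - (delta + gamma)) -
       y * (sigma ^ 2 / 2 * r ^ 2 + mu * r - (delta + gamma))) by ring.
    rewrite E, Ey; ring. }
  apply Rmult_integral in P; destruct P as [P | P]; [lra |].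
  assert (0 < y * r) by nra. nra.
Qed.

Lemma lambda_spec (mu sigma delta gamma : R) :
  0 < sigma -> 0 < delta + gamma ->
  let r := lambda mu sigma delta gamma in
  r < 0 /\ sigma ^ 2 / 2 * r ^ 2 + mu * r - (delta + gamma) = 0.
Proof.
  intros Hs Hd r.
  set (D := mu ^ 2 + 2 * sigma ^ 2 * (delta + gamma)).
  assert (S2 : 0 < sigma ^ 2) by (apply pow_lt; exact Hs).
  assert (P : 0 < sigma ^ 2 * (delta + gamma)) by (apply Rmult_lt_0_compat; assumption).
  assert (HD : 0 < D) by (unfold D; nra).
  assert (Q := sqrt_sqrt D (Rlt_le _ _ HD)).
  assert (Q0 := sqrt_lt_R0 D HD).
  assert (N : 0 < mu + sqrt D) by (unfold D in *; nra).
  assert (R0 : - (mu + sqrt D) / sigma ^ 2 < 0).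
  { apply Ropp_lt_cancel; rewrite Ropp_0.
    replace (- (- (mu + sqrt D) / sigma ^ 2)) with ((mu + sqrt D) / sigma ^ 2) by (field; lra).
    apply Rdiv_lt_0_compat; assumption. }
  assert (E : sigma ^ 2 / 2 * (- (mu + sqrt D) / sigma ^ 2) ^ 2
    + mu * (- (mu + sqrt D) / sigma ^ 2) - (delta + gamma) = 0).
  { replace (sigma ^ 2 / 2 * (- (mu + sqrt D) / sigma ^ 2) ^ 2
      + mu * (- (mu + sqrt D) / sigma ^ 2) - (delta + gamma))
      with ((sqrt D * sqrt D - (mu ^ 2 + 2 * sigma ^ 2 * (delta + gamma))) / (2 * sigma ^ 2))
      by (field; lra).
    rewrite Q; unfold D; field; lra. }
  replace r with (- (mu + sqrt D) / sigma ^ 2); [split; assumption |].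
  symmetry; apply lambda_eq; assumption.
Qed.

Lemma eta_bar_pos (mu sigma : R) : 0 < mu -> 0 < sigma -> 0 < eta_bar mu sigma.
Proof.
  intros Hm Hs; unfold eta_bar; apply Rdiv_lt_0_compat; [assert (0 < sigma ^ 2) by (apply pow_lt; exact Hs); lra | apply pow_lt; exact Hm].
Qed.

(** Modulo the quadratic for [lambda], the numerator of [f1 - mu / (2 * delta)] is [r * (delta *
    sigma ^ 2 * r + mu * (delta + gamma))]. The second factor vanishes exactly when its zero in [r]
    solves the quadratic, and that condition is linear in [gamma] once the factor [delta + gamma] is
    removed. *)
Lemma f1_eq_iff (mu sigma delta gamma : R) :
  0 < mu -> 0 < sigma -> 0 < delta -> 0 < gamma ->
  f1 mu sigma delta gamma = mu / (2 * delta) <->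
  gamma = delta * (1 + delta * eta_bar mu sigma).
Proof.
  intros Hm Hs Hd Hg.
  destruct (lambda_spec mu sigma delta gamma Hs ltac:(lra)) as [L E].
  set (r := lambda mu sigma delta gamma) in *.
  assert (S2 : 0 < sigma ^ 2) by (apply pow_lt; exact Hs).
  assert (F : f1 mu sigma delta gamma - mu / (2 * delta) =
    (2 * delta * (delta + gamma) + mu * r * (gamma - delta)) / (2 * r * delta * (delta + gamma))).
  { unfold f1; fold r; field; lra. }
  assert (N : 2 * delta * (delta + gamma) + mu * r * (gamma - delta) =
              r * (delta * sigma ^ 2 * r + mu * (delta + gamma))).
  { assert (Z : 2 * delta * (sigma ^ 2 / 2 * r ^ 2 + mu * r - (delta + gamma)) = 0)
      by (rewrite E; ring).
    lra. }
  assert (X : delta * sigma ^ 2 * r + mu * (delta + gamma) = 0 <->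
     gamma = delta * (1 + delta * eta_bar mu sigma)).
  { split; intros H.
    - assert (Hr : r = - (mu * (delta + gamma) / (delta * sigma ^ 2))).
      { apply (Rmult_eq_reg_l (delta * sigma ^ 2)); [| nra].
        field_simplify; lra. }
      assert (Y : (delta + gamma) * (mu ^ 2 * (delta + gamma) - 2 * delta * mu ^ 2 - 2 * delta ^ 2 * sigma ^ 2) = 0).
      { replace ((delta + gamma) * (mu ^ 2 * (delta + gamma) - 2 * delta * mu ^ 2 - 2 * delta ^ 2 * sigma ^ 2)) with
        (2 * delta ^ 2 * sigma ^ 2 * (sigma ^ 2 / 2 * r ^ 2 + mu * r - (delta + gamma)))
          by (rewrite Hr; field; lra).
        rewrite E; ring. }
      apply Rmult_integral in Y; destruct Y as [Y | Y]; [lra |].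
      apply (Rmult_eq_reg_l (mu ^ 2)); [| nra].
      unfold eta_bar; field_simplify; lra.
    - assert (Hr : r = - (2 * (delta * sigma ^ 2 + mu ^ 2) / (mu * sigma ^ 2))).
      { apply lambda_eq; [assumption | lra | |].
        - apply Ropp_lt_gt_0_contravar, Rdiv_lt_0_compat; nra.
        - rewrite H; unfold eta_bar; field; lra. }
      rewrite Hr, H; unfold eta_bar; field; lra. }
  rewrite <- X; clear X; split; intros H.
  - assert (Z : (2 * delta * (delta + gamma) + mu * r * (gamma - delta)) / (2 * r * delta * (delta + gamma)) = 0) by lra.
    rewrite N in Z.
    replace (r * (delta * sigma ^ 2 * r + mu * (delta + gamma)) / (2 * r * delta * (delta + gamma)))
      with ((delta * sigma ^ 2 * r + mu * (delta + gamma)) * / (2 * delta * (delta + gamma))) in Z by (field; lra).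
    apply Rmult_integral in Z; destruct Z as [Z | Z]; [exact Z |].
    exfalso; revert Z; apply Rinv_neq_0_compat; nra.
  - assert (f1 mu sigma delta gamma - mu / (2 * delta) = 0); [| lra].
    rewrite F, N, H; field; lra.
Qed.

Lemma gamma_bar1_eq (mu sigma delta : R) :
  0 < mu -> 0 < sigma -> 0 < delta ->
  gamma_bar1 mu sigma delta = delta * (1 + delta * eta_bar mu sigma).
Proof.
  intros Hm Hs Hd; assert (He := eta_bar_pos mu sigma Hm Hs).
  unfold gamma_bar1, inverse_on; apply (iota_unique (V := R_CompleteNormedModule)); unfold half_line.
  - intros y [Hy E]; apply f1_eq_iff in E; assumption.
  - assert (P : 0 < delta * (1 + delta * eta_bar mu sigma))
      by (apply Rmult_lt_0_compat; [| assert (0 < delta * eta_bar mu sigma) by (apply Rmult_lt_0_compat; assumption)]; lra).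
    split; [exact P | apply f1_eq_iff; try assumption; reflexivity].
Qed.

(** [alpha - 1] is the factor [delta * sigma ^ 2 * r + mu * (delta + gamma)] met in [f1_eq_iff],
    divided by the negative [gamma * sigma ^ 2 * r]; the bound on [gamma] has to make that factor
    negative. *)
Lemma one_lt_alpha (mu sigma delta gamma : R) :
  0 < mu -> 0 < sigma -> 0 < delta -> 0 < gamma < gamma_bar1 mu sigma delta ->
  1 < alpha mu sigma delta gamma.
Proof.
  intros Hm Hs Hd [Hg1 Hg2]; rewrite gamma_bar1_eq in Hg2 by assumption.
  destruct (lambda_spec mu sigma delta gamma Hs ltac:(lra)) as [L E].
  unfold alpha; set (r := lambda mu sigma delta gamma) in *.
  assert (S2 : 0 < sigma ^ 2) by (apply pow_lt; exact Hs).
  assert (K : mu ^ 2 * gamma < delta * mu ^ 2 + 2 * delta ^ 2 * sigma ^ 2).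
  { apply (Rmult_lt_compat_l (mu ^ 2)) in Hg2; [| apply pow_lt; exact Hm].
    replace (mu ^ 2 * (delta * (1 + delta * eta_bar mu sigma))) with
      (delta * mu ^ 2 + 2 * delta ^ 2 * sigma ^ 2) in Hg2 by (unfold eta_bar; field; lra).
    exact Hg2. }
  assert (M : delta * sigma ^ 2 * r + mu * (delta + gamma) < 0).
  { apply Rnot_le_lt; intros N.
    (* Otherwise [- r] is at most [q], where the quadratic is too small. *)
    set (q := mu * (delta + gamma) / (delta * sigma ^ 2)).
    assert (Pd : 0 < delta * sigma ^ 2) by (apply Rmult_lt_0_compat; assumption).
    assert (Hq : delta * sigma ^ 2 * q = mu * (delta + gamma)) by (unfold q; field; lra).
    assert (Q : - r <= q) by (apply (Rmult_le_reg_l (delta * sigma ^ 2)); lra).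
    assert (T : sigma ^ 2 / 2 * q < mu + delta * sigma ^ 2 / mu).
    { unfold q. apply (Rmult_lt_reg_l (2 * delta * mu)); [nra |].
      replace (2 * delta * mu * (sigma ^ 2 / 2 * (mu * (delta + gamma) / (delta * sigma ^ 2))))
        with (mu ^ 2 * (delta + gamma)) by (field; lra).
      replace (2 * delta * mu * (mu + delta * sigma ^ 2 / mu)) with
        (2 * delta * mu ^ 2 + 2 * delta ^ 2 * sigma ^ 2) by (field; lra).
      lra. }
    assert (U : sigma ^ 2 / 2 * (- r) < mu + delta * sigma ^ 2 / mu) by nra.
    assert (V : (- r) * (sigma ^ 2 / 2 * (- r)) < (- r) * (mu + delta * sigma ^ 2 / mu))
      by (apply Rmult_lt_compat_l; lra).
    assert (W : mu * (delta + gamma) < (- r) * (delta * sigma ^ 2)).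
    { replace (delta + gamma) with (sigma ^ 2 / 2 * r ^ 2 + mu * r) by lra.
      apply (Rmult_lt_compat_l mu) in V; [| exact Hm].
      replace (mu * (- r * (mu + delta * sigma ^ 2 / mu))) with
        (- r * (mu ^ 2 + delta * sigma ^ 2)) in V by (field; lra).
      nra. }
    lra. }
  assert (X : (gamma + delta) / gamma * (1 + mu / (sigma ^ 2 * r)) - 1 =
     (delta * sigma ^ 2 * r + mu * (delta + gamma)) * / (gamma * (sigma ^ 2 * r))).
  { field; lra. }
  assert (I : / (gamma * (sigma ^ 2 * r)) < 0).
  { apply Rinv_lt_0_compat. assert (0 < gamma * sigma ^ 2) by (apply Rmult_lt_0_compat; assumption). nra. }
  nra.
Qed.

Lemma alpha_lt (mu sigma delta gamma : R) :
  0 < mu -> 0 < sigma -> 0 < delta -> 0 < gamma ->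
  alpha mu sigma delta gamma < (gamma + delta) / gamma.
Proof.
  intros Hm Hs Hd Hg.
  destruct (lambda_spec mu sigma delta gamma Hs ltac:(lra)) as [L _].
  unfold alpha; set (r := lambda mu sigma delta gamma) in *.
  assert (S2 : 0 < sigma ^ 2) by (apply pow_lt; exact Hs).
  assert (I : / (sigma ^ 2 * r) < 0) by (apply Rinv_lt_0_compat; nra).
  assert (0 < (gamma + delta) / gamma) by (apply Rdiv_lt_0_compat; lra).
  unfold Rdiv at 2; assert (mu * / (sigma ^ 2 * r) < 0) by nra.
  nra.
Qed.

(** * The three pieces *)

(** [v_low] with the barrier and [k = delta * eta_bar] left free. Without a dividend and with
    interior control the equation is [- v'^2 / v'' = k * v], solved by powers of exponent
    [k / (1 + k)]; the prefactor makes the slope 1 at [b]. *)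
Definition low (b k x : R) : R :=
  (1 + k) * Rpower b (1 / (1 + k)) / k * Rpower x (k / (1 + k)).

Definition low_slope (b k x : R) : R :=
  Rpower b (1 / (1 + k)) * Rpower x (- (1 / (1 + k))).

Definition low_curv (b k x : R) : R := - (low_slope b k x / ((1 + k) * x)).

(** Euler's relation for a homogeneous function; it leaves [low_slope] as the only power in later
    computations. *)
Lemma low_eq (b k x : R) :
  0 < k -> 0 < x -> low b k x = (1 + k) / k * (x * low_slope b k x).
Proof.
  intros Hk Hx; unfold low, low_slope.
  replace (k / (1 + k)) with (1 + - (1 / (1 + k))) by (field; lra).
  rewrite (Rpower_plus 1), Rpower_1 by assumption; field; lra.
Qed.

Lemma low_slope_pos (b k x : R) : 0 < low_slope b k x.
Proof. apply Rmult_lt_0_compat; apply exp_pos. Qed.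

Lemma low_slope_self (b k : R) : 0 < b -> low_slope b k b = 1.
Proof.
  intros Hb; unfold low_slope; rewrite <- Rpower_plus, Rplus_opp_r; apply Rpower_O, Hb.
Qed.

Lemma is_derive_low_slope (b k x : R) :
  0 < k -> 0 < x -> is_derive (low_slope b k) x (low_curv b k x).
Proof.
  intros Hk Hx; unfold low_curv, low_slope.
  generalize (Rpower b (1 / (1 + k))); intros B.
  unfold Rpower; auto_derive; [exact Hx | field; lra].
Qed.

Lemma is_derive_low (b k x : R) :
  0 < k -> 0 < x -> is_derive (low b k) x (low_slope b k x).
Proof.
  intros Hk Hx.
  apply (is_derive_ext_loc (fun x => (1 + k) / k * (x * low_slope b k x))).
  - apply (filter_imp (fun y => 0 < y)); [| exact (locally_gt 0 x Hx)].
    intros y Hy; symmetry; apply low_eq; assumption.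
  - assert (D := is_derive_low_slope b k x Hk Hx).
    auto_derive; [exists (low_curv b k x); exact D |].
    rewrite (is_derive_unique (fun t : R => low_slope b k t) _ _ D); unfold low_curv; field; lra.
Qed.

Lemma continuous_low_curv (b k x : R) : 0 < k -> 0 < x -> continuous (low_curv b k) x.
Proof.
  intros Hk Hx; apply (ex_derive_continuous (low_curv b k)); unfold low_curv.
  auto_derive; split; [exists (low_curv b k x); apply is_derive_low_slope; assumption |].
  split; [nra | exact I].
Qed.

Lemma g_pos (mu sigma delta gamma y : R) :
  0 < mu -> 0 < sigma -> 0 < delta -> 0 < gamma -> 0 < g mu sigma delta gamma y.
Proof.
  intros Hm Hs Hd Hg; apply gamma_density_pos.
  assert (0 < eta_bar mu sigma * (delta + gamma)); [| lra].
  apply Rmult_lt_0_compat; [apply eta_bar_pos; assumption | lra].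
Qed.

Lemma is_derive_G (mu sigma delta gamma y : R) :
  0 < mu -> 0 < sigma -> 0 < delta -> 0 < gamma -> 0 < y ->
  is_derive (G mu sigma delta gamma) y (g mu sigma delta gamma y).
Proof.
  intros Hm Hs Hd Hg Hy; assert (He := eta_bar_pos mu sigma Hm Hs).
  apply is_derive_gamma_cdf; [| apply Rmult_lt_0_compat; assumption | exact Hy].
  assert (0 < eta_bar mu sigma * (delta + gamma)) by (apply Rmult_lt_0_compat; lra); lra.
Qed.

Lemma is_derive_g (mu sigma delta gamma y : R) :
  0 < y ->
  is_derive (g mu sigma delta gamma) y
    (g mu sigma delta gamma y * (eta_bar mu sigma * (delta + gamma) / y - gamma * eta_bar mu sigma)).
Proof.
  intros Hy.
  replace (eta_bar mu sigma * (delta + gamma) / y)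
    with ((eta_bar mu sigma * (delta + gamma) + 1 - 1) / y) by (f_equal; ring).
  apply is_derive_gamma_density, Hy.
Qed.

Lemma G_inv_G (mu sigma delta gamma y : R) :
  0 < mu -> 0 < sigma -> 0 < delta -> 0 < gamma -> 0 < y ->
  G_inv mu sigma delta gamma (G mu sigma delta gamma y) = y.
Proof.
  intros Hm Hs Hd Hg Hy; assert (He := eta_bar_pos mu sigma Hm Hs).
  apply gamma_cdf_inverse; [| apply Rmult_lt_0_compat; assumption | exact Hy].
  assert (0 < eta_bar mu sigma * (delta + gamma)) by (apply Rmult_lt_0_compat; lra); lra.
Qed.

Lemma mul_g_increasing (mu sigma delta gamma x y : R) :
  0 < mu -> 0 < sigma -> 0 < delta -> 0 < gamma ->
  0 < x -> x < y -> y <= (gamma + delta) / gamma ->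
  x * g mu sigma delta gamma x < y * g mu sigma delta gamma y.
Proof.
  intros Hm Hs Hd Hg Hx Hxy Hy; assert (He := eta_bar_pos mu sigma Hm Hs).
  destruct (mean_value (fun t => t * g mu sigma delta gamma t)
    (fun t => g mu sigma delta gamma t *
       (1 + eta_bar mu sigma * (delta + gamma - gamma * t))) x y Hxy) as [t [Ht E]].
  - intros t Ht; assert (D := is_derive_g mu sigma delta gamma t ltac:(lra)).
    auto_derive; [eexists; exact D |].
    rewrite (is_derive_unique (fun t : R => g mu sigma delta gamma t) _ _ D); field; lra.
  - assert (gamma * t <= gamma + delta).
    { replace (gamma + delta) with (gamma * ((gamma + delta) / gamma)) by (field; lra).
      apply Rmult_le_compat_l; lra. }
    assert (0 <= eta_bar mu sigma * (delta + gamma - gamma * t)) by (apply Rmult_le_pos; lra).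
    assert (P := g_pos mu sigma delta gamma t Hm Hs Hd Hg).
    assert (0 < g mu sigma delta gamma t *
       (1 + eta_bar mu sigma * (delta + gamma - gamma * t)) * (y - x))
      by (apply Rmult_lt_0_compat; [apply Rmult_lt_0_compat |]; lra).
    cbv beta in E; lra.
Qed.

Definition abscissa (mu sigma delta gamma c b y : R) : R :=
  c * (G mu sigma delta gamma y - G mu sigma delta gamma 1) + b.

Definition parameter (mu sigma delta gamma c b x : R) : R :=
  G_inv mu sigma delta gamma ((x - b) / c + G mu sigma delta gamma 1).

Definition mid (mu sigma delta gamma c b vb x : R) : R :=
  1 / (delta + gamma) *
  (c / eta_bar mu sigma * g mu sigma delta gamma (parameter mu sigma delta gamma c b x)
   + gamma * (vb + x - b)).

Definition mid_slope (mu sigma delta gamma c b x : R) : R :=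
  / parameter mu sigma delta gamma c b x.

Definition mid_curv (mu sigma delta gamma c b x : R) : R :=
  let y := parameter mu sigma delta gamma c b x in
  - / (y ^ 2 * (c * g mu sigma delta gamma y)).

Lemma abscissa_one (mu sigma delta gamma c b : R) :
  abscissa mu sigma delta gamma c b 1 = b.
Proof. unfold abscissa; ring. Qed.

Lemma parameter_abscissa (mu sigma delta gamma c b y : R) :
  0 < mu -> 0 < sigma -> 0 < delta -> 0 < gamma -> 0 < c -> 0 < y ->
  parameter mu sigma delta gamma c b (abscissa mu sigma delta gamma c b y) = y.
Proof.
  intros Hm Hs Hd Hg Hc Hy; unfold parameter, abscissa.
  match goal with |- G_inv _ _ _ _ ?z = _ =>
    replace z with (G mu sigma delta gamma y) by (field; lra) end.
  apply G_inv_G; assumption.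
Qed.

Lemma is_derive_abscissa (mu sigma delta gamma c b y : R) :
  0 < mu -> 0 < sigma -> 0 < delta -> 0 < gamma -> 0 < y ->
  is_derive (abscissa mu sigma delta gamma c b) y (c * g mu sigma delta gamma y).
Proof.
  intros Hm Hs Hd Hg Hy; assert (D := is_derive_G mu sigma delta gamma y Hm Hs Hd Hg Hy).
  unfold abscissa; auto_derive; [eexists; exact D |].
  rewrite (is_derive_unique (fun t : R => G mu sigma delta gamma t) _ _ D); ring.
Qed.

Lemma abscissa_increasing (mu sigma delta gamma c b : R) :
  0 < mu -> 0 < sigma -> 0 < delta -> 0 < gamma -> 0 < c ->
  strictly_increasing_on half_line (abscissa mu sigma delta gamma c b).
Proof.
  intros Hm Hs Hd Hg Hc.
  apply (increasing_of_derive_pos _ (fun y => c * g mu sigma delta gamma y)).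
  - intros; apply is_derive_abscissa; assumption.
  - intros; apply Rmult_lt_0_compat; [| apply g_pos]; assumption.
Qed.

Lemma abscissa_onto (mu sigma delta gamma c b y1 y2 x : R) :
  0 < mu -> 0 < sigma -> 0 < delta -> 0 < gamma -> 0 < y1 -> y1 < y2 ->
  abscissa mu sigma delta gamma c b y1 <= x <= abscissa mu sigma delta gamma c b y2 ->
  exists y, y1 <= y <= y2 /\ abscissa mu sigma delta gamma c b y = x.
Proof.
  intros Hm Hs Hd Hg H1 H2 Hx.
  destruct (f_interv_is_interv (abscissa mu sigma delta gamma c b) y1 y2 x) as [y Hy].
  - exact H2.
  - exact Hx.
  - intros t Ht; eapply is_derive_continuity_pt, is_derive_abscissa; lra.
  - exists y; exact Hy.
Qed.

Lemma is_derive_parameter (mu sigma delta gamma c b y : R) :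
  0 < mu -> 0 < sigma -> 0 < delta -> 0 < gamma -> 0 < c -> 0 < y ->
  is_derive (parameter mu sigma delta gamma c b) (abscissa mu sigma delta gamma c b y)
    (/ (c * g mu sigma delta gamma y)).
Proof.
  intros Hm Hs Hd Hg Hc Hy.
  apply (is_derive_left_inverse (abscissa mu sigma delta gamma c b)
    (fun y => c * g mu sigma delta gamma y)).
  - intros; apply is_derive_abscissa; assumption.
  - intros; apply Rmult_lt_0_compat; [| apply g_pos]; assumption.
  - intros; apply parameter_abscissa; assumption.
  - exact Hy.
Qed.

(** The chain rule cancels [c * g y] against the slope of [parameter]. What remains of [g' / g] is
    [(delta + gamma) / y - gamma], and the dividend term restores the [gamma]. *)
Lemma is_derive_mid (mu sigma delta gamma c b vb y : R) :
  0 < mu -> 0 < sigma -> 0 < delta -> 0 < gamma -> 0 < c -> 0 < y ->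
  let x := abscissa mu sigma delta gamma c b y in
  is_derive (mid mu sigma delta gamma c b vb) x (mid_slope mu sigma delta gamma c b x).
Proof.
  intros Hm Hs Hd Hg Hc Hy x.
  assert (He := eta_bar_pos mu sigma Hm Hs).
  assert (Hp := g_pos mu sigma delta gamma y Hm Hs Hd Hg).
  assert (P : parameter mu sigma delta gamma c b x = y) by (apply parameter_abscissa; assumption).
  assert (D := is_derive_parameter mu sigma delta gamma c b y Hm Hs Hd Hg Hc Hy); fold x in D.
  assert (Dg := is_derive_g mu sigma delta gamma y Hy).
  unfold mid, mid_slope; auto_derive.
  - rewrite P; split; [eexists; exact Dg | split; [eexists; exact D | exact I]].
  - rewrite P, (is_derive_unique (fun t : R => parameter mu sigma delta gamma c b t) _ _ D).
    rewrite (is_derive_unique (fun t : R => g mu sigma delta gamma t) _ _ Dg); field; lra.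
Qed.

Lemma is_derive_mid_slope (mu sigma delta gamma c b y : R) :
  0 < mu -> 0 < sigma -> 0 < delta -> 0 < gamma -> 0 < c -> 0 < y ->
  let x := abscissa mu sigma delta gamma c b y in
  is_derive (mid_slope mu sigma delta gamma c b) x (mid_curv mu sigma delta gamma c b x).
Proof.
  intros Hm Hs Hd Hg Hc Hy x.
  assert (Hp := g_pos mu sigma delta gamma y Hm Hs Hd Hg).
  assert (P : parameter mu sigma delta gamma c b x = y) by (apply parameter_abscissa; assumption).
  assert (D := is_derive_parameter mu sigma delta gamma c b y Hm Hs Hd Hg Hc Hy); fold x in D.
  unfold mid_curv, mid_slope; auto_derive.
  - rewrite P; split; [eexists; exact D | split; [lra | exact I]].
  - rewrite P, (is_derive_unique (fun t : R => parameter mu sigma delta gamma c b t) _ _ D); field; lra.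
Qed.

Lemma continuous_mid_curv (mu sigma delta gamma c b y : R) :
  0 < mu -> 0 < sigma -> 0 < delta -> 0 < gamma -> 0 < c -> 0 < y ->
  continuous (mid_curv mu sigma delta gamma c b) (abscissa mu sigma delta gamma c b y).
Proof.
  intros Hm Hs Hd Hg Hc Hy.
  set (x := abscissa mu sigma delta gamma c b y).
  assert (Hp := g_pos mu sigma delta gamma y Hm Hs Hd Hg).
  assert (P : parameter mu sigma delta gamma c b x = y) by (apply parameter_abscissa; assumption).
  assert (D := is_derive_parameter mu sigma delta gamma c b y Hm Hs Hd Hg Hc Hy); fold x in D.
  assert (Dg := is_derive_g mu sigma delta gamma y Hy).
  apply (ex_derive_continuous (mid_curv mu sigma delta gamma c b)).
  unfold mid_curv; auto_derive; rewrite P.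
  repeat split; try (eexists; eassumption).
  assert (0 < y * y * (c * g mu sigma delta gamma y)) by (apply Rmult_lt_0_compat; apply Rmult_lt_0_compat; assumption).
  simpl; lra.
Qed.

(** With [u = 1] the equation is linear: an affine particular solution plus the exponential of the
    negative root. The slope therefore tends to [gamma / (gamma + delta)]. *)
Definition top (mu lam delta gamma c3 b vb xb x : R) : R :=
  c3 * exp (lam * (x - xb)) + gamma / (gamma + delta) * (x - b + vb + mu / (delta + gamma)).

Definition top_slope (lam delta gamma c3 xb x : R) : R :=
  c3 * lam * exp (lam * (x - xb)) + gamma / (gamma + delta).

Definition top_curv (lam c3 xb x : R) : R := c3 * lam ^ 2 * exp (lam * (x - xb)).

Lemma is_derive_top (mu lam delta gamma c3 b vb xb x : R) :
  is_derive (top mu lam delta gamma c3 b vb xb) x (top_slope lam delta gamma c3 xb x).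
Proof.
  unfold top, top_slope; generalize (gamma / (gamma + delta)) (mu / (delta + gamma)); intros p q.
  auto_derive; [exact I | unfold Rminus; ring].
Qed.

Lemma is_derive_top_slope (lam delta gamma c3 xb x : R) :
  is_derive (top_slope lam delta gamma c3 xb) x (top_curv lam c3 xb x).
Proof.
  unfold top_slope, top_curv; generalize (gamma / (gamma + delta)); intros p.
  auto_derive; [exact I | unfold Rminus; ring].
Qed.

Lemma continuous_top_curv (lam c3 xb x : R) : continuous (top_curv lam c3 xb) x.
Proof.
  apply (ex_derive_continuous (top_curv lam c3 xb)); unfold top_curv; auto_derive; exact I.
Qed.

(* [W] and [Z] play the roles of [V'] and [V'']; [u] is the best control and
   paying out down to the level [b] is the best dividend. *)
Lemma solves_HJB_of_barrier (mu sigma delta gamma b : R) (V W Z : R -> R) :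
  0 < gamma -> 0 < b -> V 0 = 0 ->
  (forall x, 0 < x -> is_derive V x (W x)) ->
  (forall x, 0 < x -> is_derive W x (Z x)) ->
  (forall x, 0 < x -> Z x < 0) ->
  W b = 1 ->
  (forall x, 0 < x <= b -> x <= V x) ->
  (forall x, 0 < x -> exists u, 0 <= u <= 1 /\
     (mu * W x = - (sigma ^ 2 * Z x * u) \/ u = 1 /\ - (sigma ^ 2 * Z x) <= mu * W x) /\
     1 / 2 * sigma ^ 2 * u ^ 2 * Z x + u * mu * W x - delta * V x
       + gamma * (x - Rmin x b + V (Rmin x b) - V x) = 0) ->
  solves_HJB mu sigma delta gamma V.
Proof.
  intros Hg Hb V0 HW HZ ZN Wb Vx Hu; split; [exact V0 |]; intros x Hx.
  assert (WD := decreasing_of_derive_neg W Z HZ ZN).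
  assert (D1 : Derive V x = W x) by (apply is_derive_unique, HW, Hx).
  assert (D2 : Derive_n V 2 x = Z x).
  { change (Derive (Derive V) x = Z x); rewrite <- (is_derive_unique W x (Z x) (HZ x Hx)).
    apply Derive_ext_loc, (filter_imp (fun y => 0 < y)); [| exact (locally_gt 0 x Hx)].
    intros y Hy; apply is_derive_unique, HW, Hy. }
  set (m := Rmin x b).
  assert (Hm : 0 < m) by (apply Rmin_pos; assumption).
  assert (mx : m <= x) by apply Rmin_l. assert (mb : m <= b) by apply Rmin_r.
  assert (MV : forall y z, 0 < y -> y < z ->
    exists t, y <= t <= z /\ V z - V y = W t * (z - y)).
  { intros y z Hy Hyz; apply mean_value; [exact Hyz | intros; apply HW; lra]. }
  assert (gain : forall y, 0 <= y <= x -> V y - y <= V m - m).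
  { intros y Hy; destruct (Req_dec y 0) as [-> | Y0].
    { rewrite V0; assert (Q := Vx m (conj Hm mb)); lra. }
    destruct (Rtotal_order y m) as [L | [-> | L]]; [| lra |].
    - destruct (MV y m) as [t [Ht E]]; [lra | exact L |].
      assert (1 <= W t).
      { destruct (Req_dec t b) as [-> | N]; [lra |].
        rewrite <- Wb; left; apply WD; unfold half_line; lra. }
      nra.
    - assert (Em : m = b) by (unfold m, Rmin in *; destruct (Rle_dec x b); lra).
      destruct (MV m y) as [t [Ht E]]; [lra | exact L |].
      assert (W t <= 1).
      { destruct (Req_dec t b) as [-> | N]; [lra |].
        rewrite <- Wb; left; apply WD; unfold half_line; lra. }
      nra. }
  destruct (Hu x Hx) as [u [U1 [U2 U3]]]; fold m in U3; unfold HJB_expr; rewrite D1, D2; split.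
  - exists u, (x - m); split; [exact U1 |]; split; [lra |].
    replace (x - (x - m)) with m by ring; symmetry; exact U3.
  - intros z [w [xi [Hw [Hxi ->]]]].
    assert (Q := gain (x - xi) ltac:(lra)).
    assert (A : gamma * (xi + V (x - xi) - V x) <= gamma * (x - m + V m - V x))
      by (apply Rmult_le_compat_l; lra).
    assert (B : 1 / 2 * sigma ^ 2 * w ^ 2 * Z x + w * mu * W x <=
                1 / 2 * sigma ^ 2 * u ^ 2 * Z x + u * mu * W x).
    { assert (N : sigma ^ 2 * Z x <= 0) by (assert (0 <= sigma ^ 2) by apply pow2_ge_0;
        assert (Zx := ZN x Hx); nra).
      (* At an interior vertex the loss is [- sigma ^ 2 / 2 * Z x * (w - u) ^ 2]. Otherwise the
         vertex lies at or beyond 1, and the loss from 1 down to [w] is a sum of two nonnegative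
         terms. *)
      destruct U2 as [E | [-> E]].
      - rewrite !(Rmult_assoc _ mu), E.
        assert (0 <= (w - u) ^ 2) by apply pow2_ge_0; nra.
      - assert (0 <= (1 - w) * (mu * W x + sigma ^ 2 * Z x)) by (apply Rmult_le_pos; lra).
        assert (0 <= (1 - w) ^ 2) by apply pow2_ge_0; nra. }
    lra.
Qed.

(** * Matching the pieces at the joints and locating the two thresholds *)

Theorem proposition3p15 (mu sigma delta gamma : R)
    (hmu : 0 < mu) (hsigma : 0 < sigma) (hdelta : 0 < delta)
    (hgamma : 0 < gamma < gamma_bar1 mu sigma delta) :
  let V := v mu sigma delta gamma in
  let V' := Derive V in
  let V'' := Derive_n V 2 in
  let a := alpha mu sigma delta gamma in
  let b2g := Glb_Rbar (fun x => 0 < x /\ V' x < 1) in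
  let b1g := Glb_Rbar (fun x => 0 < x /\ - (mu / sigma ^ 2 * (V' x / V'' x)) >= 1) in
  C2_on half_line V /\
  strictly_increasing_on half_line V /\
  concave_on half_line V /\
  solves_HJB mu sigma delta gamma V /\
  b2g = Finite (b2 mu sigma delta gamma) /\
  (* the quotient V'/V'' is well defined *)
  (forall x : R, 0 < x -> V'' x <> 0) /\
  strictly_decreasing_on half_line (fun x => V' x / V'' x) /\
  (exists l : R,
     filterlim (fun x => mu / sigma ^ 2 * (V' x / V'' x)) (at_right 0) (locally l) /\
     -1 < l) /\
  b1g = Rbar_plus
          (Finite (c51 mu sigma delta gamma a *
                   (G mu sigma delta gamma a - G mu sigma delta gamma 1)))
          b2g.
Proof.
  intros V V' V'' a b2g b1g.
  assert (Ha1 := one_lt_alpha mu sigma delta gamma hmu hsigma hdelta hgamma); fold a in Ha1.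
  destruct hgamma as [hg _].
  assert (Ha2 := alpha_lt mu sigma delta gamma hmu hsigma hdelta hg); fold a in Ha2.
  destruct (lambda_spec mu sigma delta gamma hsigma ltac:(lra)) as [Hlam Elam].
  set (lam := lambda mu sigma delta gamma) in *.
  assert (He := eta_bar_pos mu sigma hmu hsigma).
  assert (Hk : 0 < delta * eta_bar mu sigma) by (apply Rmult_lt_0_compat; assumption).
  set (k := delta * eta_bar mu sigma) in *.
  assert (S2 : 0 < sigma ^ 2) by (apply pow_lt; exact hsigma).
  assert (Hga := g_pos mu sigma delta gamma a hmu hsigma hdelta hg).
  assert (Hg1 := g_pos mu sigma delta gamma 1 hmu hsigma hdelta hg).
  set (c := c51 mu sigma delta gamma a).
  assert (Hma : 0 < mu * a) by (apply Rmult_lt_0_compat; lra).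
  assert (Hc : 0 < c).
  { unfold c, c51; apply Rdiv_lt_0_compat; [| apply Rmult_lt_0_compat]; assumption. }
  (* This normalisation of [c] makes the control [mu / sigma ^ 2 * (y * (c * g y))] equal to 1 at
     [y = a]. *)
  assert (Ec : c * g mu sigma delta gamma a = sigma ^ 2 / (mu * a)).
  { unfold c, c51; field; lra. }
  set (b := b2 mu sigma delta gamma).
  assert (Hb : 0 < b).
  { apply Rdiv_lt_0_compat; [apply Rmult_lt_0_compat; assumption | fold k; lra]. }
  (* At the barrier the curvatures are [- 1 / ((1 + k) * b)] and [- 1 / (c * g 1)]; the choice of
     [b2] equates them. *)
  assert (Eb : c * g mu sigma delta gamma 1 = (1 + k) * b).
  { unfold b, b2; fold a c k; field; lra. }
  set (X := abscissa mu sigma delta gamma c b).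
  set (Y := parameter mu sigma delta gamma c b).
  set (xb := x_b2 mu sigma delta gamma).
  assert (X1 : X 1 = b) by apply abscissa_one.
  assert (Xa : X a = xb) by reflexivity.
  assert (YX : forall y, 0 < y -> Y (X y) = y)
    by (intros; apply parameter_abscissa; assumption).
  assert (Xinc := abscissa_increasing mu sigma delta gamma c b hmu hsigma hdelta hg Hc);
    fold X in Xinc; unfold strictly_increasing_on, half_line in Xinc.
  assert (Hbx : b < xb) by (rewrite <- X1, <- Xa; apply Xinc; lra).
  assert (Yb : Y b = 1) by (rewrite <- X1; apply YX; lra).
  assert (Yxb : Y xb = a) by (rewrite <- Xa; apply YX; lra).
  assert (onto : forall y1 x, 0 < y1 < a -> X y1 <= x <= xb -> exists y, y1 <= y <= a /\ X y = x).
  { intros y1 x Hy Hx; apply abscissa_onto; tauto || lra. }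
  set (c3 := c32 mu sigma delta gamma a).
  set (vb := low b k b).
  set (F := glue b (low b k)
    (glue xb (mid mu sigma delta gamma c b vb) (top mu lam delta gamma c3 b vb xb))).
  set (W := glue b (low_slope b k)
    (glue xb (mid_slope mu sigma delta gamma c b) (top_slope lam delta gamma c3 xb))).
  set (Z := glue b (low_curv b k)
    (glue xb (mid_curv mu sigma delta gamma c b) (top_curv lam c3 xb))).
  assert (V0 : V 0 = 0) by (unfold V, v; destruct (Rle_dec 0 0); [reflexivity | lra]).
  assert (VF : forall x, 0 < x -> V x = F x).
  { intros x Hx; unfold V, v; destruct (Rle_dec x 0); [lra | reflexivity]. }
  assert (Ea : gamma * a * sigma ^ 2 * lam = (delta + gamma) * (sigma ^ 2 * lam + mu)).
  { unfold a, alpha; fold lam; field; lra. }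
  assert (L2 : 0 < lam ^ 2) by nra.
  (* Matching at [xb] in orders two, one and zero. The first identity is the definition of [c32],
     the second adds that of [alpha], and the third also uses the quadratic for [lam]. *)
  assert (Ec3 : c3 * lam ^ 2 = - (mu / (sigma ^ 2 * a))).
  { unfold c3, c32; fold lam; field; lra. }
  assert (Ec3' : c3 * lam = 1 / a - gamma / (gamma + delta)).
  { apply (Rmult_eq_reg_l (a * sigma ^ 2 * lam * (gamma + delta))).
    - replace (a * sigma ^ 2 * lam * (gamma + delta) * (c3 * lam))
        with (a * sigma ^ 2 * (gamma + delta) * (c3 * lam ^ 2)) by ring.
      rewrite Ec3; field_simplify; lra.
    - apply Rmult_integral_contrapositive_currified; [| lra].
      apply Rmult_integral_contrapositive_currified; [| lra].
      apply Rmult_integral_contrapositive_currified; lra. }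
  assert (Ec3'' : c3 + gamma / (gamma + delta) * (mu / (delta + gamma)) =
    mu / (2 * a * (delta + gamma))).
  { apply (Rmult_eq_reg_l (lam ^ 2 * (2 * a * sigma ^ 2 * (delta + gamma) ^ 2))).
    - replace (lam ^ 2 * (2 * a * sigma ^ 2 * (delta + gamma) ^ 2) *
        (c3 + gamma / (gamma + delta) * (mu / (delta + gamma)))) with
        (2 * a * sigma ^ 2 * (delta + gamma) ^ 2 * (c3 * lam ^ 2)
         + 2 * mu * lam * (gamma * a * sigma ^ 2 * lam)) by (field; lra).
      rewrite Ec3, Ea.
      replace (lam ^ 2 * (2 * a * sigma ^ 2 * (delta + gamma) ^ 2) * (mu / (2 * a * (delta + gamma))))
        with (mu * (delta + gamma) * (sigma ^ 2 * lam ^ 2)) by (field; lra).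
      replace (2 * a * sigma ^ 2 * (delta + gamma) ^ 2 * - (mu / (sigma ^ 2 * a)))
        with (- (2 * mu * (delta + gamma) ^ 2)) by (field; lra).
      assert (Q : mu * (delta + gamma) * (sigma ^ 2 / 2 * lam ^ 2 + mu * lam - (delta + gamma)) = 0)
        by (rewrite Elam; ring).
      lra.
    - apply Rmult_integral_contrapositive_currified; [lra |].
      apply Rmult_integral_contrapositive_currified; [| apply pow_nonzero; lra].
      apply Rmult_integral_contrapositive_currified; lra. }
  assert (ke : k = delta * eta_bar mu sigma) by reflexivity.
  assert (Evb : vb = (1 + k) / k * b).
  { unfold vb; rewrite low_eq, low_slope_self by assumption; ring. }
  clearbody V b a lam k vb c3 xb c.
  assert (Jb : low b k b = mid mu sigma delta gamma c b vb b /\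
               low_slope b k b = mid_slope mu sigma delta gamma c b b /\
               low_curv b k b = mid_curv mu sigma delta gamma c b b).
  { unfold mid, mid_slope, mid_curv, low_curv; fold Y; rewrite Yb, low_slope_self by assumption.
    rewrite low_eq, low_slope_self by assumption.
    replace (c / eta_bar mu sigma * g mu sigma delta gamma 1) with
      (c * g mu sigma delta gamma 1 / eta_bar mu sigma) by (field; lra).
    rewrite Eb, Evb, ke; repeat split; field; lra. }
  assert (Jx : mid mu sigma delta gamma c b vb xb = top mu lam delta gamma c3 b vb xb xb /\
               mid_slope mu sigma delta gamma c b xb = top_slope lam delta gamma c3 xb xb /\
               mid_curv mu sigma delta gamma c b xb = top_curv lam c3 xb xb).
  { unfold mid, mid_slope, mid_curv, top, top_slope, top_curv; fold Y; rewrite Yxb.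
    rewrite Rminus_diag, Rmult_0_r, exp_0, !Rmult_1_r, Ec3, Ec3', Ec.
    replace (c / eta_bar mu sigma * g mu sigma delta gamma a) with
      (c * g mu sigma delta gamma a / eta_bar mu sigma) by (field; lra).
    rewrite Ec; repeat split.
    - replace (c3 + gamma / (gamma + delta) * (xb - b + vb + mu / (delta + gamma))) with
        (gamma / (gamma + delta) * (xb - b + vb)
         + (c3 + gamma / (gamma + delta) * (mu / (delta + gamma)))) by ring.
      rewrite Ec3''; unfold eta_bar; field; lra.
    - field; lra.
    - field; lra. }
  destruct Jb as [Jb0 [Jb1 Jb2]], Jx as [Jx0 [Jx1 Jx2]].
  (* Following the middle piece from parameter 1/2 instead of 1 carries it below [b], so that it is
     differentiable on both sides of [b]. *)
  assert (Xh : X (1 / 2) < b) by (rewrite <- X1; apply Xinc; lra).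
  assert (DF : forall x, 0 < x -> is_derive F x (W x)).
  { apply is_derive_glue.
    - intros x Hx; apply is_derive_low; lra.
    - intros x Hx; apply (is_derive_glue (X (1 / 2))); [| | exact Jx0 | exact Jx1 | lra].
      + intros z Hz; destruct (onto (1 / 2) z) as [y [Hy <-]]; [lra | lra |].
        apply is_derive_mid; lra.
      + intros; apply is_derive_top.
    - rewrite glue_left by lra; exact Jb0.
    - rewrite glue_left by lra; exact Jb1. }
  assert (DW : forall x, 0 < x -> is_derive W x (Z x)).
  { apply is_derive_glue.
    - intros x Hx; apply is_derive_low_slope; lra.
    - intros x Hx; apply (is_derive_glue (X (1 / 2))); [| | exact Jx1 | exact Jx2 | lra].
      + intros z Hz; destruct (onto (1 / 2) z) as [y [Hy <-]]; [lra | lra |].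
        apply is_derive_mid_slope; lra.
      + intros; apply is_derive_top_slope.
    - rewrite glue_left by lra; exact Jb1.
    - rewrite glue_left by lra; exact Jb2. }
  assert (CZ : forall x, 0 < x -> continuous Z x).
  { apply continuous_glue.
    - intros x Hx; apply continuous_low_curv; lra.
    - intros x Hx; apply (continuous_glue (X (1 / 2))); [| | exact Jx2 | lra].
      + intros z Hz; destruct (onto (1 / 2) z) as [y [Hy <-]]; [lra | lra |].
        apply continuous_mid_curv; lra.
      + intros; apply continuous_top_curv.
    - rewrite glue_left by lra; exact Jb2. }
  (* Value, slope and curvature are treated together, piece by piece; on the middle piece the point
     is [X y], so slope and curvature are explicit in [y]. *)
  assert (cases : forall P : R -> R -> R -> R -> Prop,
    (forall x, 0 < x <= b -> P x (low b k x) (low_slope b k x) (low_curv b k x)) ->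
    (forall y, 1 < y <= a -> P (X y) (mid mu sigma delta gamma c b vb (X y)) (/ y)
        (- / (y ^ 2 * (c * g mu sigma delta gamma y)))) ->
    (forall x, xb < x -> P x (top mu lam delta gamma c3 b vb xb x)
        (top_slope lam delta gamma c3 xb x) (top_curv lam c3 xb x)) ->
    forall x, 0 < x -> P x (F x) (W x) (Z x)).
  { intros P P1 P2 P3 x Hx; unfold F, W, Z, glue.
    destruct (Rle_dec x b) as [L | L]; [apply P1; lra |].
    destruct (Rle_dec x xb) as [M | M]; [| apply P3; lra].
    destruct (onto 1 x) as [y [Hy E]]; [lra | lra |].
    assert (y <> 1) by (intros ->; lra).
    assert (Q := P2 y ltac:(lra)).
    unfold mid_slope, mid_curv; fold Y; rewrite <- E, YX by lra; exact Q. }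
  (* The upper bound on [a] in the form [0 < c3 * lam]: the slope [1 / a] at [xb] exceeds the slope
     at infinity. *)
  assert (ip : 0 < 1 / a - gamma / (gamma + delta)).
  { replace (1 / a - gamma / (gamma + delta)) with
      (((gamma + delta) / gamma - a) * (gamma / (a * (gamma + delta)))) by (field; lra).
    apply Rmult_lt_0_compat; [lra |].
    apply Rdiv_lt_0_compat; [| apply Rmult_lt_0_compat]; lra. }
  assert (p0 : 0 < gamma / (gamma + delta)) by (apply Rdiv_lt_0_compat; lra).
  assert (q0 : 0 < mu / (sigma ^ 2 * a)).
  { apply Rdiv_lt_0_compat; [| apply Rmult_lt_0_compat]; lra. }
  assert (cg : forall y, 0 < c * g mu sigma delta gamma y).
  { intros; apply Rmult_lt_0_compat; [| apply g_pos]; assumption. }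
  assert (WP : forall x, 0 < x -> 0 < W x).
  { apply (cases (fun _ _ w _ => 0 < w)).
    - intros; apply low_slope_pos.
    - intros y Hy; apply Rinv_0_lt_compat; lra.
    - intros x Hx; unfold top_slope; rewrite Ec3'.
      assert (0 < exp (lam * (x - xb))) by apply exp_pos; nra. }
  assert (ZN : forall x, 0 < x -> Z x < 0).
  { apply (cases (fun _ _ _ z => z < 0)).
    - intros x Hx; unfold low_curv; apply Ropp_lt_gt_0_contravar, Rdiv_lt_0_compat.
      + apply low_slope_pos.
      + apply Rmult_lt_0_compat; lra.
    - intros y Hy; apply Ropp_lt_gt_0_contravar, Rinv_0_lt_compat, Rmult_lt_0_compat.
      + apply pow_lt; lra.
      + apply cg.
    - intros x Hx; unfold top_curv; rewrite Ec3.
      assert (0 < exp (lam * (x - xb))) by apply exp_pos; nra. }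
  assert (Wb : W b = 1).
  { unfold W; rewrite glue_left by lra; apply low_slope_self; assumption. }
  assert (WD := decreasing_of_derive_neg W Z DW ZN).
  assert (DV : forall x, 0 < x -> is_derive V x (W x)).
  { intros x Hx; apply (is_derive_ext_loc F); [| apply DF, Hx].
    apply (filter_imp (fun y => 0 < y)); [| exact (locally_gt 0 x Hx)].
    intros y Hy; symmetry; apply VF, Hy. }
  assert (EV1 : forall x, 0 < x -> V' x = W x) by (intros; apply is_derive_unique, DV; assumption).
  assert (DV1 : forall x, 0 < x -> is_derive V' x (Z x)).
  { intros x Hx; apply (is_derive_ext_loc W); [| apply DW, Hx].
    apply (filter_imp (fun y => 0 < y)); [| exact (locally_gt 0 x Hx)].
    intros y Hy; symmetry; apply EV1, Hy. }
  assert (EV2 : forall x, 0 < x -> V'' x = Z x)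
    by (intros; exact (is_derive_unique V' _ _ (DV1 _ H))).
  assert (yg : forall y, 0 < y < a -> y * (c * g mu sigma delta gamma y) < a * (c * g mu sigma delta gamma a)).
  { intros y Hy.
    assert (Q := mul_g_increasing mu sigma delta gamma y a hmu hsigma hdelta hg ltac:(lra) ltac:(lra) ltac:(lra)).
    nra. }
  assert (Eac : a * (c * g mu sigma delta gamma a) = sigma ^ 2 / mu) by (rewrite Ec; field; lra).
  (* The quotient of slope and curvature, simplified on each piece so that its monotonicity can be
     read off. *)
  set (Q := glue b (fun x => - ((1 + k) * x))
     (glue xb (fun x => - (Y x * (c * g mu sigma delta gamma (Y x))))
        (fun x => 1 / lam - gamma / (gamma + delta) * (sigma ^ 2 * a / mu) * exp (- lam * (x - xb))))).
  assert (EQ : forall x, 0 < x -> W x / Z x = Q x).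
  { intros x Hx; unfold W, Z, Q, glue.
    destruct (Rle_dec x b) as [L | L].
    { unfold low_curv; assert (P := low_slope_pos b k x); field; lra. }
    destruct (Rle_dec x xb) as [M | M].
    { destruct (onto 1 x) as [y [Hy <-]]; [lra | lra |].
      unfold mid_slope, mid_curv; fold Y; rewrite YX by lra.
      assert (P := g_pos mu sigma delta gamma y hmu hsigma hdelta hg); field; lra. }
    unfold top_slope, top_curv.
    replace (- lam * (x - xb)) with (- (lam * (x - xb))) by ring; rewrite exp_Ropp.
    assert (P := exp_pos (lam * (x - xb))); set (e := exp (lam * (x - xb))) in *.
    replace (c3 * lam * e) with (c3 * lam ^ 2 * e / lam) by (field; lra).
    rewrite Ec3; field; lra. }
  assert (QD : strictly_decreasing_on half_line Q).
  { apply (glue_strictly_decreasing 0); [| | rewrite glue_left, Yb, Eb by lra; ring].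
    { intros x y Hx Hy Hxy; nra. }
    intros x y Hx Hy Hxy.
    assert (GD := glue_strictly_decreasing (X (1 / 2)) xb
      (fun x => - (Y x * (c * g mu sigma delta gamma (Y x))))
      (fun x => 1 / lam - gamma / (gamma + delta) * (sigma ^ 2 * a / mu) * exp (- lam * (x - xb)))).
    apply GD; try lra; clear GD.
    - intros z t Hz Ht Hzt.
      destruct (onto (1 / 2) z) as [z' [Hz' <-]]; [lra | lra |].
      destruct (onto (1 / 2) t) as [t' [Ht' <-]]; [lra | lra |].
      rewrite !YX by lra.
      assert (zt : z' < t').
      { apply Rnot_le_lt; intros [N | N]; [apply Xinc in N; lra | rewrite N in Hzt; lra]. }
      assert (I := mul_g_increasing mu sigma delta gamma z' t' hmu hsigma hdelta hg
        ltac:(lra) ltac:(lra) ltac:(lra)).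
      nra.
    - intros z t Hz Ht Hzt.
      assert (exp (- lam * (z - xb)) < exp (- lam * (t - xb))) by (apply exp_increasing; nra).
      assert (0 < gamma / (gamma + delta) * (sigma ^ 2 * a / mu)).
      { apply Rmult_lt_0_compat; [assumption | apply Rdiv_lt_0_compat; nra]. }
      nra.
    (* Continuity of the quotient at [xb] is once more the definition of [alpha], in the form
       [Ea]. *)
    - rewrite Yxb, Eac, Rminus_diag, Rmult_0_r, exp_0.
      apply (Rmult_eq_reg_l (mu * lam * (delta + gamma))).
      + replace (mu * lam * (delta + gamma) * - (sigma ^ 2 / mu))
          with (- (sigma ^ 2 * lam * (delta + gamma))) by (field; lra).
        match goal with |- _ = ?z => replace z with
          (mu * (delta + gamma) - gamma * a * sigma ^ 2 * lam) by (field; lra) end.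
        rewrite Ea; ring.
      + apply Rmult_integral_contrapositive_currified; [| lra].
        apply Rmult_integral_contrapositive_currified; lra. }
  assert (Qxb : mu / sigma ^ 2 * Q xb = -1).
  { unfold Q; rewrite glue_right, glue_left, Yxb, Eac.
    - field; lra.
    - lra.
    - rewrite glue_left, Yb, Eb by lra; ring.
    - lra. }
  assert (ms : 0 < mu / sigma ^ 2) by (apply Rdiv_lt_0_compat; assumption).
  assert (EVQ : forall x, 0 < x -> V' x / V'' x = Q x).
  { intros x Hx; rewrite EV1, EV2, EQ by assumption; reflexivity. }
  assert (Eb2 : b2g = Finite b).
  { apply Glb_Rbar_up_set.
    - intros x [Hx Lx]; rewrite EV1 in Lx by assumption.
      apply Rnot_lt_le; intros N; assert (M := WD x b Hx Hb N); lra.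
    - intros x Hx; split; [lra |]; rewrite EV1, <- Wb by lra.
      apply WD; unfold half_line; lra. }
  assert (HJB : solves_HJB mu sigma delta gamma V).
  { apply (solves_HJB_of_barrier mu sigma delta gamma b V W Z); try assumption.
    - intros x Hx; rewrite VF by lra; unfold F; rewrite glue_left, low_eq by lra.
      assert (1 <= low_slope b k x).
      { destruct (Req_dec x b) as [-> | N]; [rewrite low_slope_self; lra |].
        assert (M := WD x b ltac:(unfold half_line; lra) Hb ltac:(lra)).
        unfold W in M at 2; rewrite glue_left in M; lra. }
      assert (1 <= (1 + k) / k).
      { replace ((1 + k) / k) with (1 + / k) by (field; lra).
        assert (0 < / k) by (apply Rinv_0_lt_compat; assumption); lra. }
      assert (x <= x * low_slope b k x) by nra; nra.
    - intros x Hx.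
      assert (Fb : V b = vb) by (rewrite VF by assumption; unfold F;
        rewrite glue_left, low_eq, low_slope_self, Evb by lra; ring).
      rewrite VF by assumption; revert x Hx.
      apply (cases (fun x f w z => exists u, 0 <= u <= 1 /\
        (mu * w = - (sigma ^ 2 * z * u) \/ u = 1 /\ - (sigma ^ 2 * z) <= mu * w) /\
        1 / 2 * sigma ^ 2 * u ^ 2 * z + u * mu * w - delta * f
          + gamma * (x - Rmin x b + V (Rmin x b) - f) = 0)).
      + intros x Hx; exists (mu / sigma ^ 2 * ((1 + k) * x)).
        assert (P := low_slope_pos b k x).
        rewrite Rmin_left, VF by lra; unfold F; rewrite glue_left by lra.
        unfold low_curv; split; [split |].
        * apply Rlt_le, Rmult_lt_0_compat; [| apply Rmult_lt_0_compat]; lra.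
        * apply Rle_trans with (mu / sigma ^ 2 * ((1 + k) * b)).
          { apply Rmult_le_compat_l; [lra | apply Rmult_le_compat_l; lra]. }
          (* At [b] the control is [mu / sigma ^ 2 * (c * g 1)]; comparing parameters 1 and [a]
             keeps it below 1. *)
          assert (M := yg 1 ltac:(lra)); rewrite Rmult_1_l, Eb, Eac in M.
          apply Rlt_le, (Rmult_lt_reg_l (sigma ^ 2 / mu));
            [apply Rdiv_lt_0_compat; assumption |].
          replace (sigma ^ 2 / mu * (mu / sigma ^ 2 * ((1 + k) * b))) with ((1 + k) * b)
            by (field; lra); lra.
        * split; [left; field; lra |].
          rewrite low_eq by lra; revert P; generalize (low_slope b k x); intros w P.
          replace (delta * ((1 + k) / k * (x * w))) with (mu ^ 2 / (2 * sigma ^ 2) * ((1 + k) * (x * w)))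
            by (rewrite ke in *; unfold eta_bar in *; field; lra).
          field; lra.
      + intros y Hy; set (d := c * g mu sigma delta gamma y) in *.
        exists (mu / sigma ^ 2 * (y * d)).
        assert (Hd := cg y); fold d in Hd.
        assert (b < X y) by (rewrite <- X1; apply Xinc; lra).
        rewrite Rmin_right, Fb by lra; split; [split |].
        * apply Rlt_le, Rmult_lt_0_compat; [| apply Rmult_lt_0_compat]; lra.
        * assert (M : y * d <= sigma ^ 2 / mu).
          { rewrite <- Eac; destruct (Req_dec y a) as [E | N];
              [unfold d; rewrite E; lra | left; apply yg; lra]. }
          apply (Rmult_le_reg_l (sigma ^ 2 / mu));
            [apply Rdiv_lt_0_compat; assumption |].
          replace (sigma ^ 2 / mu * (mu / sigma ^ 2 * (y * d))) with (y * d)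
            by (field; lra); lra.
        * split; [left; field; lra |].
          unfold mid; fold Y; rewrite YX by lra.
          replace (c / eta_bar mu sigma * g mu sigma delta gamma y) with (d / eta_bar mu sigma)
            by (unfold d; field; lra).
          unfold eta_bar; field; lra.
      + intros x Hx; exists 1; split; [lra |].
        assert (P := exp_pos (lam * (x - xb))).
        rewrite Rmin_right, Fb by lra.
        unfold top_slope, top_curv, top.
        assert (e1 : exp (lam * (x - xb)) < 1) by (rewrite <- exp_0; apply exp_increasing; nra).
        set (e := exp (lam * (x - xb))) in *; split.
        (* The slope is [e / a + gamma / (gamma + delta) * (1 - e)] and [- sigma ^ 2] times the
           curvature is [mu * e / a], so the gap is a multiple of [1 - e]. *)
        * right; split; [reflexivity |]; rewrite Ec3, Ec3'.
          assert (0 < mu * (gamma / (gamma + delta)) * (1 - e))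
            by (apply Rmult_lt_0_compat; [apply Rmult_lt_0_compat |]; lra).
          replace (- (sigma ^ 2 * (- (mu / (sigma ^ 2 * a)) * e))) with (mu * (1 / a) * e)
            by (field; lra).
          lra.
        (* The affine part of [top] cancels against the dividend, leaving the exponential times the
           quadratic for [lam]. *)
        * assert (c3 * e * (sigma ^ 2 / 2 * lam ^ 2 + mu * lam - (delta + gamma)) = 0)
            by (rewrite Elam; ring).
          match goal with |- ?z = 0 => replace z with
            (c3 * e * (sigma ^ 2 / 2 * lam ^ 2 + mu * lam - (delta + gamma))) by (field; lra) end.
          assumption. }
  split; [| split; [| split; [| split; [exact HJB |]]]];
    [| | | split; [exact Eb2 | split; [| split; [| split]]]].
  - intros x Hx; split; [| split].
    + exists (W x); apply DV; assumption.
    + exists (Z x); apply DV1; assumption.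
    + apply (continuous_ext_loc _ Z); [| apply CZ; assumption].
      apply (filter_imp (fun y => 0 < y)); [| exact (locally_gt 0 x Hx)].
      intros y Hy; symmetry; apply EV2, Hy.
  - apply (increasing_of_derive_pos V W DV WP).
  - apply (concave_of_derive_decreasing V W DV WD).
  - intros x Hx; rewrite EV2 by assumption; assert (M := ZN x Hx); lra.
  - intros x y Hx Hy Hxy; rewrite !EVQ by assumption; apply QD; assumption.
  (* Near 0 the quotient is [- ((1 + k) * x)], which vanishes in the limit. *)
  - exists 0; split; [| lra].
    apply (filterlim_ext_loc (fun x => mu / sigma ^ 2 * - ((1 + k) * x))).
    + exists (mkposreal b Hb); intros x Hx H0.
      change (Rabs (x - 0) < b) in Hx; rewrite Rminus_0_r, Rabs_pos_eq in Hx by lra.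
      rewrite EVQ by assumption; unfold Q; rewrite glue_left by lra; reflexivity.
    + apply (filterlim_filter_le_1 (G := at_right 0) (F := locally 0)).
      * intros P HP; exact (filter_imp (F := locally 0) P _ (fun x Hx _ => Hx) HP).
      * replace (locally 0) with (locally (mu / sigma ^ 2 * - ((1 + k) * 0))) at 2 by (f_equal; ring).
        apply (ex_derive_continuous (fun x => mu / sigma ^ 2 * - ((1 + k) * x)) 0).
        auto_derive; exact I.
  - rewrite Eb2; unfold Rbar_plus; simpl.
    change (b1g = Finite (abscissa mu sigma delta gamma c b a)); fold X; rewrite Xa.
    apply Glb_Rbar_up_set.
    + intros x [Hx Lx]; rewrite EVQ in Lx by assumption.
      apply Rnot_lt_le; intros N.
      assert (M := QD x xb Hx ltac:(unfold half_line; lra) N); nra.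
    + intros x Hx; split; [lra |]; rewrite EVQ by lra.
      assert (M := QD xb x ltac:(unfold half_line; lra) ltac:(unfold half_line; lra) Hx); nra.
Qed.
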